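(* Let $d\ge 1$ be fixed and let $m_n\to\infty$ as $n\to\infty$. Let $X_n\in\mathbb{R}^{n\times d}$, $y_n\in\mathbb{R}^n$ be deterministic, $\lambda_n>0$, and let $H_n,g_n,A_n,\beta_n,r_n$, the sketch rows $s_{n,1},\dots,s_{n,m_n}\in\mathbb{R}^n$, the compressed rows $(z_{n,i},u_{n,i})$, the sketched estimator $\widehat\beta_{n,m_n}$ and the influence vectors $\psi_{n,i}$ be as defined in the context. Assume: (i) as $n\to\infty$, $\lambda_n\to\lambda_\infty\ge 0$, $H_n\to H$, $g_n\to g$ (finite limits), and there is $c_0>0$ with $\lambda_{\min}(H_n+\lambda_n I_d)\ge c_0$ for all sufficiently large $n$; (ii) for every $n$, $s_{n,1},\dots,s_{n,m_n}$ are i.i.d. with $\mathbb{E}(s_{n,1}s_{n,1}^\top)=I_n$; $$\sup_n \mathbb{E}\Big[\|z_{n,1}z_{n,1}^\top-H_n\|_{\mathrm F}^4+\|z_{n,1}u_{n,1}-g_n\|_2^4\Big]<\infty;$$ and there is a finite matrix $\Omega\in\mathbb{R}^{d\times d}$ such that $\Omega_n:=\mathbb{E}(\psi_{n,1}\psi_{n,1}^\top)\to\Omega$. Then $$\sqrt{m_n}\,(\widehat\beta_{n,m_n}-\beta_n)=\frac1{\sqrt{m_n}}\sum_{i=1}^{m_n}\psi_{n,i}+o_p(1).$$ The covariance matrix of $\psi_{n,i}$ is $\Omega_n$, the leading sum $m_n^{-1/2}\sum_{i=1}^{m_n}\psi_{n,i}$ also has covariance matrix $\Omega_n$, and $\Omega_n\to\Omega$.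 If, in addition, the coordinates of $s_{n,i}$ are independent copies of a scalar random variable $s$ with $\mathbb{E}s=0$, $\mathbb{E}s^2=1$, $\mathbb{E}|s|^4<\infty$, then, with $\kappa_s:=\mathbb{E}s^4-3$, $$\Omega_n=A_n\left\{\frac{\|r_n\|_2^2}{n}H_n+\lambda_n^2\beta_n\beta_n^\top+\frac{\kappa_s}{n^2}X_n^\top\operatorname{diag}(r_n\odot r_n)X_n\right\}A_n^\top .$$
   Context: All limits are along one sequence $n\to\infty$ with $d$ fixed. Define $H_n:=\frac1n X_n^\top X_n$, $g_n:=\frac1n X_n^\top y_n$, $A_n:=(H_n+\lambda_n I_d)^{-1}$, $\beta_n:=A_ng_n$ (the minimizer over $\beta\in\mathbb{R}^d$ of $\frac1n\|X_n\beta-y_n\|_2^2+\lambda_n\|\beta\|_2^2$), and $r_n:=y_n-X_n\beta_n$. For random sketch rows $s_{n,1},\dots,s_{n,m}\in\mathbb{R}^n$ define $z_{n,i}:=n^{-1/2}X_n^\top s_{n,i}\in\mathbb{R}^d$, $u_{n,i}:=n^{-1/2}y_n^\top s_{n,i}\in\mathbb{R}$, $\widehat H_{n,m}:=\frac1m\sum_{i=1}^m z_{n,i}z_{n,i}^\top$, $\widehat g_{n,m}:=\frac1m\sum_{i=1}^m z_{n,i}u_{n,i}$, and the sketched estimator $\widehat\beta_{n,m}:=(\widehat H_{n,m}+\lambda_nI_d)^{-1}\widehat g_{n,m}$. The influence vectors are $$\psi_{n,i}:=A_n\{z_{n,i}(u_{n,i}-z_{n,i}^\top\beta_n)-\lambda_n\beta_n\}=\tfrac1n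 A_nX_n^\top(s_{n,i}s_{n,i}^\top-I_n)r_n,$$ which have mean zero when the rows are isotropic. $\|\cdot\|_2$ is the Euclidean norm, $\|\cdot\|_{\mathrm F}$ the Frobenius norm, $\lambda_{\min}$ the smallest eigenvalue, $\odot$ the componentwise product, and $\operatorname{diag}(a)$ the diagonal matrix with diagonal $a$. $o_p(1)$ denotes a term converging to $0$ in probability with respect to the law of the sketch. *)

(* Defs.v *)
From HB Require Import structures.
From mathcomp Require Import all_boot all_order all_algebra.
From mathcomp Require Import all_classical all_reals all_analysis.
Set Implicit Arguments.
Unset Strict Implicit.
Unset Printing Implicit Defensive.
Import Order.TTheory GRing.Theory Num.Theory.
Import numFieldNormedType.Exports.
Local Open Scope classical_set_scope.
Local Open Scope ring_scope.

Section LinearAlgebra.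
Context {R : realType}.

Definition norm2 d (v : 'cV[R]_d) : R := Num.sqrt (\sum_i v i 0 ^+ 2).

Definition normF p q (M : 'M[R]_(p, q)) : R :=
  Num.sqrt (\sum_i \sum_j M i j ^+ 2).

(* Meant for symmetric [M] of positive size: the set of real eigenvalues is
   then finite and nonempty, and the infimum is its least element. *)
Definition lambda_min d (M : 'M[R]_d) : R := inf [set a : R | eigenvalue M a].

(* Random vectors take values in [n.-tuple R], which carries the product Borel
   sigma-algebra; [tcol] views such a tuple as an element of R^n. *)
Definition tcol n (t : n.-tuple R) : 'cV[R]_n := \col_j tnth t j.

End LinearAlgebra.

Section Ridge.
Context {R : realType} {n d : nat}.
Variables (X : 'M[R]_(n, d)) (y : 'cV[R]_n) (lam : R).

Definition Hmx : 'M[R]_d := n%:R^-1 *: (X^T *m X).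
Definition gvec : 'cV[R]_d := n%:R^-1 *: (X^T *m y).
Definition Amx : 'M[R]_d := invmx (Hmx + lam%:M).
Definition beta : 'cV[R]_d := Amx *m gvec.
Definition resid : 'cV[R]_n := y - X *m beta.

Definition zrow (t : n.-tuple R) : 'cV[R]_d :=
  (Num.sqrt n%:R)^-1 *: (X^T *m tcol t).
Definition urow (t : n.-tuple R) : R :=
  (Num.sqrt n%:R)^-1 * (y^T *m tcol t) 0 0.

Definition psi (t : n.-tuple R) : 'cV[R]_d :=
  Amx *m ((urow t - ((zrow t)^T *m beta) 0 0) *: zrow t - lam *: beta).

Definition Hhat m (t : 'I_m -> n.-tuple R) : 'M[R]_d :=
  m%:R^-1 *: \sum_i zrow (t i) *m (zrow (t i))^T.
Definition ghat m (t : 'I_m -> n.-tuple R) : 'cV[R]_d :=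
  m%:R^-1 *: \sum_i urow (t i) *: zrow (t i).
Definition betahat m (t : 'I_m -> n.-tuple R) : 'cV[R]_d :=
  invmx (Hhat t + lam%:M) *m ghat t.

End Ridge.

Section Probability.
Context {R : realType}.

Definition mutually_independent disp (T : measurableType disp)
    (P : probability T R) dispU (U : measurableType dispU) (I : finType)
    (V : I -> T -> U) : Prop :=
  forall (J : {set I}) (B : I -> set U),
    (forall i, measurable (B i)) ->
    P (\bigcap_(i in [set i | i \in J]) (V i @^-1` B i)) =
    (\prod_(i in J) P (V i @^-1` B i))%E.

Definition same_law disp (T : measurableType disp) (P : probability T R)
    disp' (T' : measurableType disp') (P' : probability T' R)
    dispU (U : measurableType dispU) (V : T -> U) (V' : T' -> U) : Prop :=
  forall B : set U, measurable B -> P (V @^-1` B) = P' (V' @^-1` B).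

Definition iid disp (T : measurableType disp) (P : probability T R)
    dispU (U : measurableType dispU) (I : finType) (V : I -> T -> U) : Prop :=
  mutually_independent P V /\ forall i j, same_law P P (V i) (V j).

(* [fine] sends an infinite expectation to 0, so this is the expectation of
   [M] only when the entries of [M] are integrable. *)
Definition mean_mx disp (T : measurableType disp) (P : probability T R)
    p q (M : T -> 'M[R]_(p, q)) : 'M[R]_(p, q) :=
  \matrix_(i, j) fine ('E_P[fun w => M w i j])%E.

(* The covariances are extended reals; equating them with real numbers forces
   the coordinates of a measurable [V] to be square-integrable. *)
Definition has_covariance disp (T : measurableType disp) (P : probability T R)
    d (V : T -> 'cV[R]_d) (C : 'M[R]_d) : Prop :=
  forall k l, covariance P (fun w => V w k 0) (fun w => V w l 0) =
    (C k l)%:E.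

(* [V n] = o_p(1): random vectors, on probability spaces that may change with
   [n], converging to 0 in probability. *)
Definition is_op1 (disp : nat -> measure_display)
    (T : forall n, measurableType (disp n)) (P : forall n, probability (T n) R)
    d (V : forall n, T n -> 'cV[R]_d) : Prop :=
  (forall n k, measurable_fun setT (fun w => V n w k 0)) /\
  forall eps : R, 0 < eps ->
    P n [set w | eps < norm2 (V n w)] @[n --> \oo] --> (0 : \bar R)%E.

End Probability.

Definition Omega (R : realType) disp (T : measurableType disp)
    (P : probability T R) n d (X : 'M[R]_(n, d)) (y : 'cV[R]_n) (lam : R)
    (S : T -> n.-tuple R) : 'M[R]_d :=
  mean_mx P (fun w => psi X y lam (S w) *m (psi X y lam (S w))^T).

(* Main.v *)
Require Import Defs.
From HB Require Import structures.
From mathcomp Require Import all_boot all_order all_algebra.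
From mathcomp Require Import all_classical all_reals all_analysis.
From mathcomp Require Import measurable_realfun complex ring lra.
Set Implicit Arguments.
Unset Strict Implicit.
Unset Printing Implicit Defensive.
Import Order.TTheory GRing.Theory Num.Theory.
Import numFieldNormedType.Exports.
Local Open Scope classical_set_scope.
Local Open Scope ring_scope.

(** Put M_n = H_n + lambda_n I, Mhat = Hhat + lambda_n I and let W be the
    leading sum m^{-1/2} sum_i psi_i.  As (1/m) sum_i psi_i =
    A_n (ghat - Mhat beta_n), the remainder is exactly Mhat^{-1} (H_n - Hhat) W.
    The rows being i.i.d., Hhat - H_n has entrywise second moments O(1/m) and W
    has covariance Omega_n, so (H_n - Hhat) W tends to 0 in probability.  By the
    spectral theorem det M_n >= c_0^d, which passes to the limit; hence lim M_n
    is invertible and Mhat^{-1} is bounded as soon as Mhat is close to M_n.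

    When the coordinates are independent, psi is A_n applied to
    (1/n) X^T (s s^T - I) r, and Omega_n follows from the fourth mixed moments
    E s_j s_k s_l s_p, in which every index occurring only once gives 0. *)

(** * Expectations and independence *)

(** Two obstacles shape the proof. When lambda_n tends to 0, no bound on the inverse of Mhat holds
    for every sketch, so an expectation of the remainder is never taken. Inverses are bounded on a
    deterministic neighbourhood only; leaving it and having a large remainder are charged to one
    nonnegative variable, so that a single Markov inequality settles both. Moreover, independence is
    given as a factorisation of probabilities of events. Products of expectations require
    identifying a joint law with a product measure, and the fourth mixed moments require a triple of
    coordinates, possibly with repetitions, to be independent of a single one. The moment hypothesis
    enters through t <= 1 + t^2 with t a squared norm, which bounds the second moments of the
    entries of z z^T - H_n by 1 + K. Estimates are made at fixed n with explicit constants, and the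
    limit is taken only at the end. *)

Section Mean.
Context {R : realType} disp (T : measurableType disp) (P : probability T R).
Implicit Types f g : T -> R.

Definition integ f := P.-integrable setT (EFin \o f).
(** Real-valued, so that moments can be computed in the field. As [fine] sends infinities to 0, a
    value of [mean] is meaningful only together with [integ], which is why several lemmas deliver
    both. *)
Definition mean f : R := fine ('E_P[f])%E.

Lemma mean_EFin f : integ f -> ('E_P[f] = (mean f)%:E)%E.
Proof. by move=> fi; rewrite /mean fineK// unlock integrable_fin_num. Qed.

Lemma integ_measurable f : integ f -> measurable_fun setT f.
Proof. by move=> /measurable_int/measurable_EFinP. Qed.

Lemma integ_cst (a : R) : integ (fun=> a).
Proof. exact: finite_measure_integrable_cst. Qed.

Lemma mean_cst (a : R) : mean (fun=> a) = a.
Proof. by rewrite /mean expectation_cst. Qed.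

Lemma integD f g : integ f -> integ g -> integ (fun x => f x + g x).
Proof. exact: integrableD. Qed.

Lemma meanD f g : integ f -> integ g ->
  mean (fun x => f x + g x) = mean f + mean g.
Proof.
by move=> fi gi; rewrite /mean unlock integralD_EFin// fineD//
  integrable_fin_num.
Qed.

Lemma integZ (a : R) f : integ f -> integ (fun x => a * f x).
Proof. exact: integrableZl. Qed.

Lemma meanZ (a : R) f : integ f -> mean (fun x => a * f x) = a * mean f.
Proof.
move=> fi; rewrite /mean unlock; under eq_integral do rewrite EFinM.
by rewrite integralZl// fineM// integrable_fin_num.
Qed.

Lemma integ_sum I (r : seq I) (F : I -> T -> R) :
  (forall i, integ (F i)) -> integ (fun x => \sum_(i <- r) F i x).
Proof.
move=> Fi; elim: r => [|i r ih].
  by under eq_fun do rewrite big_nil; exact: integ_cst.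
by under eq_fun do rewrite big_cons; exact: integD.
Qed.

Lemma mean_sum I (r : seq I) (F : I -> T -> R) : (forall i, integ (F i)) ->
  mean (fun x => \sum_(i <- r) F i x) = \sum_(i <- r) mean (F i).
Proof.
move=> Fi; elim: r => [|i r ih].
  by under eq_fun do rewrite big_nil; rewrite mean_cst big_nil.
under eq_fun do rewrite big_cons; rewrite meanD ?ih ?big_cons//.
exact: integ_sum.
Qed.

Lemma integ_le f g : measurable_fun setT f -> (forall x, `|f x| <= g x) ->
  integ g -> integ f.
Proof.
move=> mf fg; apply: le_integrable => //; first exact/measurable_EFinP.
by move=> x _ /=; rewrite lee_fin (le_trans (fg x))// ler_norm.
Qed.

Lemma le_mean f g : integ f -> integ g -> (forall x, f x <= g x) ->
  mean f <= mean g.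
Proof.
move=> fi gi fg; rewrite -lee_fin -!mean_EFin// unlock;
  apply: le_integral => //.
by move=> x _; rewrite lee_fin.
Qed.

(** Measurability of [f] is recorded separately because it does not follow from that of its
    square. *)
Definition sqint f := measurable_fun setT f /\ integ (fun x => f x ^+ 2).

Lemma integ_sqintM f g : sqint f -> sqint g -> integ (fun x => f x * g x).
Proof.
move=> [mf f2] [mg g2]; apply: integ_le (integD f2 g2).
  exact: measurable_funM.
move=> x; rewrite normrM -(real_normK (num_real (f x))).
rewrite -(real_normK (num_real (g x))).
have := sqr_ge0 (`|f x| - `|g x|).
move: (normr_ge0 (f x)) (normr_ge0 (g x)); nra.
Qed.

Lemma sqint_cst (a : R) : sqint (fun=> a).
Proof. by split=> //; exact: integ_cst. Qed.

Lemma sqint_integ f : sqint f -> integ f.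
Proof.
move=> fs; have := integ_sqintM fs (sqint_cst 1).
by under eq_fun do rewrite mulr1.
Qed.

Lemma sqintD f g : sqint f -> sqint g -> sqint (fun x => f x + g x).
Proof.
move=> fs gs; have [mf f2] := fs; have [mg g2] := gs.
split; first exact: measurable_funD.
have -> : (fun x => (f x + g x) ^+ 2) =
    (fun x => (f x ^+ 2 + g x ^+ 2) + 2 * (f x * g x)).
  by apply/funext => x; ring.
by apply: integD; [exact: integD | exact/integZ/integ_sqintM].
Qed.

Lemma sqintZ (a : R) f : sqint f -> sqint (fun x => a * f x).
Proof.
move=> [mf f2]; split; first exact: measurable_funM.
by under eq_fun do rewrite exprMn; exact: integZ.
Qed.

Lemma sqint_sum I (r : seq I) (F : I -> T -> R) :
  (forall i, sqint (F i)) -> sqint (fun x => \sum_(i <- r) F i x).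
Proof.
move=> Fi; elim: r => [|i r ih].
  by under eq_fun do rewrite big_nil; exact: sqint_cst.
by under eq_fun do rewrite big_cons; exact: sqintD.
Qed.

(** Markov's inequality at level 1: the indicator of the event lies below [f]. Other thresholds are
    absorbed into the choice of [f]. *)
Lemma prob_ge1_le_mean f : integ f -> (forall x, 0 <= f x) ->
  (P [set x | (1 <= f x)%R] <= (mean f)%:E)%E.
Proof.
move=> fi f0; rewrite -mean_EFin//.
have mf := integ_measurable fi.
have mA : measurable [set x | 1 <= f x].
  by rewrite -[X in measurable X]setTI; exact: measurable_fun_ler.
rewrite -(expectation_indic P mA) unlock; apply: ge0_le_integral => //.
- by apply/measurable_EFinP; exact: measurable_indic.
- exact/measurable_EFinP.
move=> x _; rewrite lee_fin indicE.
by have [|_] := boolP (x \in _); [rewrite inE | rewrite f0].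
Qed.

End Mean.

(** * Change of variables, and expectation of a product of independent variables *)

Section Law.
Context {R : realType}.

Lemma mfun_ex d1 d2 (T : measurableType d1) (U : measurableType d2)
  (X : T -> U) : measurable_fun setT X -> exists Y : {mfun T >-> U}, Y = X :>
    (T -> U).
Proof. by move=> mX; exists (mfun_Sub (mem_set mX)); rewrite mfun_valP. Qed.

(** Both integrals are integrals of [f] against the common image measure; the absolute value is
    treated first, to get integrability. The two probability spaces may differ, so this serves for
    rows of one sketch and for comparison with the scalar variable. *)
Lemma same_law_integ d1 d2 d3 (T : measurableType d1) (T' : measurableType d2)
    (U : measurableType d3) (P : probability T R) (P' : probability T' R)
    (X : T -> U) (X' : T' -> U) (f : U -> R) :
  measurable_fun setT X -> measurable_fun setT X' -> measurable_fun setT f ->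
  same_law P P' X X' -> integ P (f \o X) ->
  integ P' (f \o X') /\ mean P' (f \o X') = mean P (f \o X).
Proof.
move=> /mfun_ex[Y <-] /mfun_ex[Y' <-] mf XX' fX.
have lawE g : (\int[distribution P Y]_u g u = \int[distribution P' Y']_u g u)%E.
  by apply: eq_measure_integral => A mA _; exact: XX'.
have mEf : measurable_fun setT (EFin \o f) by exact/measurable_EFinP.
have fX' : integ P' (f \o Y').
  apply/integrableP; split; first by apply/measurable_EFinP/measurableT_comp.
  move/integrableP : fX => [_].
  have mabs : measurable_fun setT (fun u => `|(f u)%:E|)%E by exact:
    measurableT_comp.
  rewrite -(@ge0_integral_distribution _ _ _ _ _ P Y (fun u => `|(f
    u)%:E|)%E)//.
  by rewrite lawE ge0_integral_distribution.
split=> //; rewrite /mean unlock; congr fine.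
rewrite -(@integral_distribution _ _ _ _ _ P Y (EFin \o f))//.
by rewrite lawE integral_distribution.
Qed.

Context d (T : measurableType d) (P : probability T R).

(** Unlike in [mutually_independent], the two codomains may differ, which allows a triple of
    coordinates to stand against a single one. *)
Definition indep d1 d2 (U : measurableType d1) (V : measurableType d2)
    (X : T -> U) (Y : T -> V) := forall A B, measurable A -> measurable B ->
  (P (X @^-1` A `&` Y @^-1` B) = P (X @^-1` A) * P (Y @^-1` B))%E.

Lemma indep_comp d1 d2 d3 d4 (U : measurableType d1) (V : measurableType d2)
    (U' : measurableType d3) (V' : measurableType d4)
    (X : T -> U) (Y : T -> V) (f : U -> U') (g : V -> V') :
  measurable_fun setT f -> measurable_fun setT g ->
  indep X Y -> indep (f \o X) (g \o Y).
Proof.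
move=> mf mg XY A B mA mB.
by apply: (XY (f @^-1` A) (g @^-1` B)); rewrite -[X in measurable X]setTI;
  [exact: mf|exact: mg].
Qed.

(** Independence makes the joint law the product of the marginal laws, since the two agree on
    rectangles. Tonelli applied to [|x y| = |x| |y|] then gives integrability, and Fubini the
    value. *)
Lemma indep_meanM (X Y : T -> R) : indep X Y -> integ P X -> integ P Y ->
  integ P (fun w => X w * Y w) /\
  mean P (fun w => X w * Y w) = mean P X * mean P Y.
Proof.
move=> + Xi Yi; have mX := integ_measurable Xi; have mY := integ_measurable Yi.
have [X' XE] := mfun_ex mX; have [Y' YE] := mfun_ex mY.
have [Z ZE] := mfun_ex (measurable_fun_pair mX mY).
rewrite -XE -YE in Xi Yi ZE *; move=> ind {mX mY X Y XE YE}.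
pose h (p : R * R) : R := p.1 * p.2.
have mh : measurable_fun setT h by exact: measurable_funM.
have mEh : measurable_fun setT (EFin \o h) by exact/measurable_EFinP.
have law g : (\int[distribution P Z]_u g u =
    \int[distribution P X' \x distribution P Y']_u g u)%E.
  apply: eq_measure_integral => A mA _; apply/esym.
  apply: product_measure_unique => // B C mB mC.
  by rewrite /= /distribution /pushforward ZE; exact: ind.
have mN : measurable_fun setT (fun x : R => `|x%:E|)%E.
  by apply: measurableT_comp => //; exact/measurable_EFinP.
have eX : (\int[distribution P X']_x `|x%:E| = \int[P]_w `|(X' w)%:E|)%E.
  by rewrite ge0_integral_distribution.
have eY : (\int[distribution P Y']_x `|x%:E| = \int[P]_w `|(Y' w)%:E|)%E.
  by rewrite ge0_integral_distribution.
have prodi : (distribution P X' \x distribution P Y')%E.-integrable setT (EFin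
  \o h).
  apply/integrable12ltyP => //.
  have hE x y : (`|(EFin \o h) (x, y)| = `|x%:E| * `|y%:E|)%E by rewrite -abseM.
  under eq_integral do under eq_integral do rewrite hE.
  under eq_integral do rewrite ge0_integralZl// eY.
  rewrite ge0_integralZr//; last exact: integral_ge0.
  rewrite eX; move/integrableP : Xi => [_ Xi]; move/integrableP : Yi => [_ Yi].
  by rewrite lte_mul_pinfty// ?integral_ge0// ge0_fin_numE// integral_ge0.
have hZ : (fun w => X' w * Y' w) = h \o Z by rewrite ZE.
have hi : integ P (h \o Z).
  apply/integrableP; split; first by apply/measurable_EFinP/measurableT_comp.
  move/integrableP : prodi => [_]; rewrite -law ge0_integral_distribution//.
  exact: measurableT_comp.
rewrite hZ; split => //; apply: EFin_inj.
rewrite -mean_EFin// unlock.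
rewrite -(@integral_distribution _ _ _ _ _ P Z (EFin \o h))// law.
rewrite -integral12_prod_meas1// /fubini_F/=.
have mE : measurable_fun setT (@EFin R) by exact/measurable_EFinP.
have iY : (distribution P Y').-integrable setT (@EFin R).
  by apply/integrableP; split=> //; rewrite eY; case/integrableP : Yi.
have iX : (distribution P X').-integrable setT (@EFin R).
  by apply/integrableP; split=> //; rewrite eX; case/integrableP : Xi.
under eq_integral do under eq_integral do rewrite /h/= EFinM.
under eq_integral do rewrite integralZl//.
rewrite EFinM -!mean_EFin// unlock.
rewrite -(@integral_distribution _ _ _ _ _ P Y' (@EFin R))//.
rewrite -(@integral_distribution _ _ _ _ _ P X' (@EFin R))//.
(* The mean of [Y] is finite, so it may be replaced by a real [r] and pulled out of the outer
   integral. *)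
have := integrable_fin_num measurableT iY.
move: (integral _ _ _) => [r||]//= _.
by rewrite integralZr.
Qed.

End Law.

(** * Independence of a group of variables from another variable *)

Section Grouping.
Context {R : realType} d (T : measurableType d) (P : probability T R).

(* A pi-system argument: if the event [F] factors out of every rectangle
   [X in A, Y in B], intersected with [G], it factors out of every event of the
   pair [(X, Y)]. *)
Lemma factor_pair d1 d2 (U : measurableType d1) (V : measurableType d2)
    (X : T -> U) (Y : T -> V) (G F : set T) :
  measurable_fun setT X -> measurable_fun setT Y ->
  measurable G -> measurable F ->
  (forall A B, measurable A -> measurable B ->
    P ((X @^-1` A `&` Y @^-1` B) `&` (G `&` F)) =
    (P ((X @^-1` A `&` Y @^-1` B) `&` G) * P F)%E) ->
  forall C, measurable C -> let Z w := (X w, Y w) in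
    P (Z @^-1` C `&` (G `&` F)) = (P (Z @^-1` C `&` G) * P F)%E.
Proof.
move=> mX mY mG mF XYF C mC /=.
have [Z ZE] := mfun_ex (measurable_fun_pair mX mY).
rewrite -ZE.
(* [m1] and [m2] are the two sides of the claim seen as finite measures in [C]. Scaling takes a
   nonnegative real, hence [fine (P F)]. *)
pose m1f := [the measure _ _ of pushforward
  [the measure _ _ of mrestr P (measurableI _ _ mG mF)] Z].
pose m1 := m1f (@measurable_funP _ _ _ _ _ Z).
have PF0 : (0 <= fine (P F))%R by rewrite fine_ge0.
pose m2f := [the measure _ _ of pushforward
  [the measure _ _ of mrestr P mG] Z].
pose m2 := [the measure _ _ of mscale (NngNum PF0)
  (m2f (@measurable_funP _ _ _ _ _ Z))].
suff : m1 C = m2 C.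
  rewrite /m1 /m1f /m2 /m2f/= /mscale/= /pushforward /mrestr fineK
    ?fin_num_measure//.
  by rewrite muleC.
apply: (measure_unique [set A `*` B | A in measurable & B in measurable]
   (fun=> setT)) => //.
- exact: measurable_prod_measurableType.
- move=> _ _ [A mA [B mB <-]] [A' mA' [B' mB' <-]].
  rewrite -setXI; exists (A `&` A'); first exact: measurableI.
  by exists (B `&` B') => //; exact: measurableI.
- by move=> _; exists setT => //; exists setT => //; rewrite setXTT.
- by rewrite bigcup_const.
- move=> _ [A mA [B mB <-]].
  rewrite /m1 /m1f /m2 /m2f/= /mscale/= /pushforward /mrestr/= ZE.
  by rewrite fineK ?fin_num_measure// muleC; exact: XYF.
- move=> _; rewrite /m1 /m1f/= /pushforward /mrestr/= preimage_setT setTI.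
  rewrite (le_lt_trans (probability_le1 _ _)) ?ltry//; exact: measurableI.
Qed.

Context dU (U : measurableType dU) (I : finType) (V : I -> T -> U).
Hypothesis mV : forall i, measurable_fun setT (V i).
Hypothesis indV : mutually_independent P V.

(** Mutual independence is used twice, for [l |: J] and for [J], with the family [B] overridden by
    [D] at [l]. *)
Lemma mutually_independentU1 (J : {set I}) (l : I) (B : I -> set U) (D : set U)
  :
  l \notin J -> (forall i, measurable (B i)) -> measurable D ->
  P (\bigcap_(i in [set i | i \in J]) (V i @^-1` B i) `&` V l @^-1` D) =
  (P (\bigcap_(i in [set i | i \in J]) (V i @^-1` B i)) * P (V l @^-1` D))%E.
Proof.
move=> lJ mB mD; pose B' i := if i == l then D else B i.
have mB' i : measurable (B' i) by rewrite /B'; case: ifP.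
have B'J i : i \in J -> B' i = B i.
  by rewrite /B' => iJ; case: eqP => // il; rewrite -il iJ in lJ.
have B'l : B' l = D by rewrite /B' eqxx.
have := indV (l |: J)%SET mB'.
rewrite big_setU1//= B'l.
under eq_bigr => i iJ do rewrite B'J//.
rewrite -indV// muleC => <-; congr (P _).
apply/seteqP; split => w /=.
  move=> [wJ wl] i /=; rewrite in_setU1 => /orP[/eqP->|iJ];
    first by rewrite B'l.
  by rewrite B'J//; exact: wJ.
move=> wJ; split; last by rewrite -B'l; apply: wJ; rewrite /= in_setU1 eqxx.
by move=> i /= iJ; rewrite -(B'J i iJ); apply: wJ; rewrite /= in_setU1 iJ orbT.
Qed.

Lemma mutually_independent_indep (i j : I) : i != j -> indep P (V i) (V j).
Proof.
move=> ij A B mA mB.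
have h := @mutually_independentU1 [set i]%SET j (fun=> A) B.
have E : \bigcap_(k in [set k | k \in [set i]%SET]) (V k @^-1` A) = V i @^-1` A.
  apply/seteqP; split => w /=; first by apply; rewrite /= finset.inE.
  by move=> wA k /=; rewrite finset.inE => /eqP->.
by rewrite E in h; apply: h => //; rewrite finset.inE eq_sym.
Qed.

(** The case of rectangles follows from mutual independence. [factor_pair] then extends it twice: to
    events of [(V j, V k)] with the event of [V p] held fixed, and to events of the whole triple. *)
Lemma mutually_independent_triple (j k p l : I) : l != j -> l != k -> l != p ->
  indep P (fun w => ((V j w, V k w), V p w)) (V l).
Proof.
move=> lj lk lp C D mC mD.
have mVi i (A : set U) : measurable A -> measurable (V i @^-1` A).
  by move=> mA; rewrite -[X in measurable X]setTI; exact: mV.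
have mjk : measurable_fun setT (fun w => (V j w, V k w)).
  exact: measurable_fun_pair.
have triple_rect (A1 A2 B : set U) : measurable A1 -> measurable A2 ->
    measurable B -> P ((V j @^-1` A1 `&` V k @^-1` A2 `&` V p @^-1` B) `&`
      V l @^-1` D) = (P (V j @^-1` A1 `&` V k @^-1` A2 `&` V p @^-1` B) *
      P (V l @^-1` D))%E.
  move=> mA1 mA2 mB.
  (* The indices [j], [k], [p] may coincide; [W i] intersects all the constraints that fall on [i],
     so coincidences need no separate cases. *)
  pose W i := (if i == j then A1 else setT) `&` (if i == k then A2 else setT)
    `&` (if i == p then B else setT).
  have mW i : measurable (W i).
    by apply: measurableI; [apply: measurableI|]; case: ifP.
  have E : \bigcap_(i in [set i | i \in [set j; k; p]%SET]) (V i @^-1` W i) =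
      V j @^-1` A1 `&` V k @^-1` A2 `&` V p @^-1` B.
    apply/seteqP; split => w /=.
      move=> h; split; [split|].
      - by have := h j; rewrite /= !finset.inE eqxx => /(_ isT);
          rewrite /W eqxx => -[[]].
      - by have := h k; rewrite /= !finset.inE eqxx orbT => /(_ isT);
          rewrite /W eqxx => -[[]].
      - by have := h p; rewrite /= !finset.inE eqxx orbT => /(_ isT);
          rewrite /W eqxx => -[].
    move=> [[wj wk] wp] i _; rewrite /W; split; [split|].
    - by case: eqP => [->|].
    - by case: eqP => [->|].
    - by case: eqP => [->|].
  have := @mutually_independentU1 [set j; k; p]%SET l W D.
  by rewrite E; apply => //; rewrite !finset.inE !negb_or lj lk lp.
pose Vjk w := (V j w, V k w).
have Vjkp A B : measurable A -> measurable B ->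
    P ((Vjk @^-1` A `&` V p @^-1` B) `&` (setT `&` V l @^-1` D)) =
    (P ((Vjk @^-1` A `&` V p @^-1` B) `&` setT) * P (V l @^-1` D))%E.
  move=> mA mB; rewrite setTI setIT -setIA.
  apply: (@factor_pair _ _ _ _ (V j) (V k) (V p @^-1` B) (V l @^-1` D)) => //;
    [exact: mVi|exact: mVi|move=> A1 A2 mA1 mA2 {A mA}].
  rewrite setIA.
  exact: (triple_rect A1 A2 B).
have := factor_pair mjk (mV p) measurableT (mVi _ _ mD) Vjkp mC.
by rewrite /= setTI setIT.
Qed.

End Grouping.

(** * Second moments of sums of i.i.d. terms *)

Section IidSum.
Context {R : realType} d (T : measurableType d) (P : probability T R).
Context dU (U : measurableType dU) (m : nat) (V : 'I_m -> T -> U).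
Hypothesis mV : forall i, measurable_fun setT (V i).
Hypothesis iidV : iid P V.
Variables (i0 : 'I_m).

Lemma iid_mean (f : U -> R) i : measurable_fun setT f ->
  integ P (f \o V i0) ->
  integ P (f \o V i) /\ mean P (f \o V i) = mean P (f \o V i0).
Proof. by move=> mf fi; apply: same_law_integ => //; exact: iidV.2. Qed.

Lemma iid_sqint (f : U -> R) i : measurable_fun setT f ->
  sqint P (f \o V i0) -> sqint P (f \o V i).
Proof.
move=> mf [_ f2]; split; first exact: measurableT_comp.
have mf2 : measurable_fun setT (fun u => f u ^+ 2) by exact: measurable_funX.
by have [] := iid_mean i mf2 f2.
Qed.

(** Expanding the product, an off-diagonal term factors by independence and vanishes since [f] is
    centred; the [m] diagonal terms are equal by equality of laws. *)
Lemma iid_mean_sumM (f g : U -> R) :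
  measurable_fun setT f -> measurable_fun setT g ->
  sqint P (f \o V i0) -> sqint P (g \o V i0) -> mean P (f \o V i0) = 0 ->
  mean P (fun w => (\sum_i f (V i w)) * \sum_i g (V i w)) =
  m%:R * mean P (fun w => f (V i0 w) * g (V i0 w)).
Proof.
move=> mf mg fs gs f0.
have fgi i j : integ P (fun w => f (V i w) * g (V j w)).
  by apply: integ_sqintM; [exact: (iid_sqint i mf)|exact: (iid_sqint j mg)].
under eq_fun do rewrite big_distrlr/=.
rewrite mean_sum; last by move=> i; exact: integ_sum.
rewrite (eq_bigr (fun=> mean P (fun w => f (V i0 w) * g (V i0 w)))).
  by rewrite sumr_const card_ord mulr_natl.
move=> i _; rewrite mean_sum// (bigD1 i)//= big1 ?addr0.
  have mfg : measurable_fun setT (fun u => f u * g u) by exact: measurable_funM.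
  by have [_ ->] := iid_mean i mfg (fgi i0 i0).
move=> j ji; have [] := @indep_meanM _ _ _ P (f \o V i) (g \o V j).
- apply: indep_comp => //; apply: (mutually_independent_indep iidV.1).
  by rewrite eq_sym.
- exact/sqint_integ/iid_sqint.
- exact/sqint_integ/iid_sqint.
by move=> _ ->; have [_ ->] := iid_mean i mf (sqint_integ fs); rewrite f0 mul0r.
Qed.

End IidSum.

(** * Mixed moments of independent standardised coordinates *)

Section FourthMoment.
Context {R : realType} d (T : measurableType d) (P : probability T R).
Context d0 (T0 : measurableType d0) (P0 : probability T0 R) (s : T0 -> R).
Context (I : finType) (V : I -> T -> R).
Hypothesis mV : forall i, measurable_fun setT (V i).
Hypothesis indV : mutually_independent P V.
Hypothesis ms : measurable_fun setT s.
Hypothesis Vs : forall i, same_law P P0 (V i) s.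
Hypothesis s1 : mean P0 s = 0.
Hypothesis s2 : mean P0 (fun w => s w ^+ 2) = 1.
Hypothesis s4 : integ P0 (fun w => s w ^+ 4).

Let sq_sqint : sqint P0 (fun w => s w ^+ 2).
Proof.
split; first exact: measurable_funX.
by under eq_fun do rewrite -exprM; exact: s4.
Qed.

Let powV k i : integ P0 (fun w => s w ^+ k) ->
  integ P (fun w => V i w ^+ k) /\
  mean P (fun w => V i w ^+ k) = mean P0 (fun w => s w ^+ k).
Proof.
move=> sk; apply: (@same_law_integ _ _ _ _ _ _ _ P0 P s (V i) (fun x => x ^+
  k)) => //.
by move=> B mB; apply/esym; exact: Vs.
Qed.

Let V_sqint i : sqint P (V i).
Proof. by split=> //; have [] := powV i (sqint_integ sq_sqint). Qed.

Let V2_sqint i : sqint P (fun w => V i w ^+ 2).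
Proof.
split; first exact: measurable_funX.
by under eq_fun do rewrite -exprM; have [] := powV i s4.
Qed.

Let meanV i : mean P (V i) = 0.
Proof.
have E (S : Type) (f : S -> R) : (fun w => f w ^+ 1) = f.
  by apply/funext => w; rewrite expr1.
have := @powV 1 i; rewrite !E s1 => -[] //; apply: (@sqint_integ _ _ _ P0 s).
by split => //; exact: (sqint_integ sq_sqint).
Qed.

Let meanV2 i : mean P (fun w => V i w ^+ 2) = 1.
Proof. by have [_ ->] := powV i (sqint_integ sq_sqint). Qed.

Let VM_sqint i j : sqint P (fun w => V i w * V j w).
Proof.
split; first exact: measurable_funM.
under eq_fun do rewrite exprMn.
exact: integ_sqintM.
Qed.

Lemma integ_mul4 j k l p : integ P (fun w => V j w * V k w * (V l w * V p w)).
Proof. exact: integ_sqintM. Qed.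

Lemma integ_mul2 j k : integ P (fun w => V j w * V k w).
Proof. exact: integ_sqintM. Qed.

Lemma mean_mul2 j k : mean P (fun w => V j w * V k w) = (j == k)%:R.
Proof.
have [<-|jk] := eqVneq j k; first by rewrite -(meanV2 j).
have [_ ->] := indep_meanM (mutually_independent_indep indV jk)
  (sqint_integ (V_sqint j)) (sqint_integ (V_sqint k)).
by rewrite meanV mul0r.
Qed.

(** [V l] is independent of the triple of the other factors, which may coincide among themselves,
    and has mean zero. *)
Let mean4_uniq j k p l : l != j -> l != k -> l != p ->
  mean P (fun w => V j w * V k w * V p w * V l w) = 0.
Proof.
move=> lj lk lp; have ind := mutually_independent_triple mV indV lj lk lp.
pose h (x : R * R * R) := x.1.1 * x.1.2 * x.2.
have mh : measurable_fun setT h.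
  apply: measurable_funM; last exact: measurable_snd.
  by apply: measurable_funM; [exact: (measurableT_comp measurable_fst)|
    exact: (measurableT_comp measurable_snd)].
have [] := indep_meanM (indep_comp mh (@measurable_id _ _ setT) ind).
- by rewrite /comp/h/=; exact: integ_sqintM.
- exact: (sqint_integ (V_sqint l)).
by move=> _; rewrite /h/= => ->; rewrite meanV mulr0.
Qed.

Let mean22 j l : j != l ->
  mean P (fun w => V j w * V j w * (V l w * V l w)) = 1.
Proof.
move=> jl; have ind := mutually_independent_indep indV jl.
have mX : measurable_fun [set: R] (fun x : R => x ^+ 2) by exact:
  (measurable_funX _ (@measurable_id _ _ setT)).
have [] := indep_meanM (indep_comp mX mX ind).
- exact: (sqint_integ (V2_sqint j)).
- exact: (sqint_integ (V2_sqint l)).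
by move=> _; rewrite /= meanV2 meanV2 mulr1.
Qed.

(** Wick's formula with a kurtosis correction. The first three terms are the three pairings of four
    indices; when all indices agree they add up to 3, so the correction is the fourth moment minus
    3. Any pattern other than two pairs or four equal indices has an index occurring once. *)
Lemma mean_mul4 j k l p :
  mean P (fun w => V j w * V k w * (V l w * V p w)) =
  ((j == k) && (l == p))%:R + ((j == l) && (k == p))%:R
  + ((j == p) && (k == l))%:R
  + (mean P0 (fun w => s w ^+ 4) - 3) * [&& j == k, j == l & j == p]%:R.
Proof.
(* [perm4] reorders the factors into the shapes already computed; in particular [uniq0] expects the
   index occurring once in last position. *)
have perm4 (F G : T -> R) : F =1 G -> mean P F = mean P G.
  by move=> /funext->.
have uniq0 a b c e : e != a -> e != b -> e != c ->
    mean P (fun w => V a w * V b w * V c w * V e w) = 0 by exact: mean4_uniq.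
have [jk|jk] := eqVneq j k.
  subst k; have [lp|lp] := eqVneq l p.
    subst p; have [jl|jl] := eqVneq j l => /=.
      subst l; rewrite mulr1.
      rewrite (perm4 _ (fun w => V j w ^+ 4)); last by move=> w; ring.
      by have [_ ->] := powV j s4; ring.
    by rewrite mean22//= ?mulr0n ?mulr1n; ring.
  have pl : p != l by rewrite eq_sym.
  have [jl|jl] := eqVneq j l => /=.
    subst l; rewrite (negPf lp) /= (perm4 _ (fun w => V j w * V j w * V j w * V
      p w)).
      by rewrite uniq0//= ?mulr0n ?mulr0; ring.
    by move=> w; ring.
  have lj : l != j by rewrite eq_sym.
  rewrite andbF (perm4 _ (fun w => V j w * V j w * V p w * V l w)).
    by rewrite uniq0//= ?mulr0n ?mulr0; ring.
  by move=> w; ring.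
have kj : k != j by rewrite eq_sym.
have [jl|jl] := eqVneq j l => /=.
  subst l; rewrite (negPf kj) andbF.
  have [kp|kp] := eqVneq k p => /=.
    subst p; rewrite (perm4 _ (fun w => V j w * V j w * (V k w * V k w))).
      by rewrite mean22//= ?mulr0n ?mulr1n; ring.
    by move=> w; ring.
  rewrite (perm4 _ (fun w => V j w * V j w * V p w * V k w)).
    by rewrite uniq0//= ?mulr0n ?mulr0; ring.
  by move=> w; ring.
have [jp|jp] := eqVneq j p => /=.
  subst p; have [kl|kl] := eqVneq k l => /=.
    subst l; rewrite (perm4 _ (fun w => V j w * V j w * (V k w * V k w))).
      by rewrite mean22//= ?mulr0n ?mulr1n; ring.
    by move=> w; ring.
  rewrite (perm4 _ (fun w => V j w * V j w * V l w * V k w)).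
    by rewrite uniq0//= ?mulr0n ?mulr0; ring.
  by move=> w; ring.
rewrite (perm4 _ (fun w => V k w * V l w * V p w * V j w)).
  by rewrite uniq0//= ?mulr0n ?mulr0; ring.
by move=> w; ring.
Qed.

End FourthMoment.

(** * Determinants and inverses near a limit *)

Section MatrixLemmas.
Context {R : realType}.

(** Complexifying [M] gives a Hermitian matrix, unitarily diagonalisable with real diagonal [sp].
    Being an eigenvalue is insensitive to the field extension, so every entry of [sp] is the image
    of an eigenvalue of [M]; the determinant is their product. *)
Lemma det_ge_eigenvalue d (M : 'M[R]_d) (c : R) : 0 < c -> M^T = M ->
  (forall a, eigenvalue M a -> c <= a) -> c ^+ d <= \det M.
Proof.
move=> c0 Msym Mc; pose f := real_complex R; pose MC := map_mx f M.
have MCh : MC \is hermsymmx.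
  apply: realsym_hermsym.
    apply/is_hermitianmxP; rewrite expr0 scale1r map_mx_id//.
    by apply/matrixP => i j; rewrite !mxE -[in LHS]Msym mxE.
  by apply/mxOverP => i j; rewrite !mxE; apply/complex_realP; exists (M i j).
have spr := hermitian_spectral_diag_real MCh.
have MCE := orthomx_spectralP (hermitian_normalmx MCh).
set P := spectralmx MC in MCE; set sp := spectral_diag MC in spr MCE.
have Pu : P \in unitmx := spectral_unit MC.
have spE i : exists2 a, sp 0 i = f a & c <= a.
  have /complex_realP[a spa] := mxOverP spr 0 i.
  exists a => //; apply: Mc; rewrite -(eigenvalue_map f)
    -[X in eigenvalue _ X]/(a%:C)%C -spa.
  (* Row [i] of the diagonalising matrix is a left eigenvector, nonzero because that matrix is
     invertible. *)
  apply/eigenvalueP; exists (row i P).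
    rewrite -row_mul -/MC {1}MCE mulmxA mulmxA mulmxV// mul1mx.
    by rewrite row_mul row_diag_mx -scalemxAl -rowE.
  apply/eqP => /(congr1 (mulmx^~ (invmx P))).
  rewrite -row_mul mulmxV// mul0mx => /rowP/(_ i).
  by rewrite !mxE eqxx => /eqP; rewrite oner_eq0.
have detE : f (\det M) = \prod_i sp 0 i.
  transitivity (\det MC); first by rewrite det_map_mx.
  rewrite MCE !det_mulmx det_diag mulrAC -det_mulmx mulVmx//.
  by rewrite det1 mul1r.
rewrite -lecR -/f detE.
have -> : f (c ^+ d) = \prod_(i < d) f c.
  by rewrite prodr_const card_ord /f rmorphXn.
apply: ler_prod => i _; have [a -> ca] := spE i.
by rewrite /f ler0c lecR ltW.
Qed.

Lemma continuous_scale (T : topologicalType) (a : R) (f : T -> R) :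
  continuous f -> continuous (fun x => a * f x).
Proof. by move=> cf x; apply: (@cvgMl_tmp _ _ (nbhs x)); exact: cf. Qed.

Lemma continuous_det d : continuous (fun M : 'M[R]_d => \det M).
Proof.
apply: continuous_big => [|s _]; first exact: add_continuous.
apply: continuous_scale.
apply: continuous_big => [|i _]; first exact: mul_continuous.
exact: coord_continuous.
Qed.

Lemma continuous_adjugate d i j :
  continuous (fun M : 'M[R]_d => (\adj M) i j).
Proof.
under eq_fun do rewrite mxE.
apply: continuous_scale; apply: continuous_big => [|s _].
  exact: add_continuous.
apply: continuous_scale; apply: continuous_big => [|k _].
  exact: mul_continuous.
under eq_fun do rewrite !mxE.
exact: coord_continuous.
Qed.

(** By Cramer's formula the entries of the inverse are quotients of polynomials in the entries of
    the matrix, continuous wherever the determinant is nonzero. *)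
Lemma invmx_bounded_near d (K : 'M[R]_d) : K \in unitmx ->
  exists delta B : R, [/\ 0 < delta, 0 <= B & forall N : 'M[R]_d,
    (forall i j, `|N i j - K i j| < delta) ->
    N \in unitmx /\ forall i j, `|invmx N i j| <= B].
Proof.
move=> Ku; have dK : \det K != 0 by rewrite -unitfE -unitmxE.
(* A sum of nonnegative terms dominates each of them; the added 1 is the tolerance in [adjN]. *)
pose B := \sum_i \sum_j (`|(\det K)^-1 * (\adj K) i j| + 1).
have dN : \forall N \near K, \det N != 0.
  exact: (@cvgr_neq0 R R^o _ (nbhs K) (nbhs_filter K) (@determinant R d) _
    (@continuous_det d K) dK).
have adjN : \forall N \near K, forall ij : 'I_d * 'I_d,
    `|(\det N)^-1 * (\adj N) ij.1 ij.2
      - (\det K)^-1 * (\adj K) ij.1 ij.2| < 1.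
  apply: (@filter_forall _ _ _ _ (nbhs_filter K)) => -[i j] /=.
  have cv : (\det N)^-1 * (\adj N) i j @[N --> K] -->
      (\det K)^-1 * (\adj K) i j.
    apply: (@cvgM _ _ _ (nbhs_filter K)); last exact: continuous_adjugate.
    by apply: (@cvgV _ _ _ (nbhs_filter K)) => //; exact: continuous_det.
  exact: (@cvgr_distC_lt R R^o _ (nbhs K) (nbhs_filter K) _ _ cv _ ltr01).
have /(nbhs_ballP K)[e /= e0 eK] := @filterI _ _ (nbhs_filter K) _ _ dN adjN.
exists e, B; split => //.
  by do 2 (apply: sumr_ge0 => ? _); rewrite addr_ge0.
move=> N NK; have [{}dN {}adjN] : \det N != 0 /\
    forall ij : 'I_d * 'I_d, `|(\det N)^-1 * (\adj N) ij.1 ij.2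
      - (\det K)^-1 * (\adj K) ij.1 ij.2| < 1.
  by apply: eK; split => // i j; rewrite /ball/= distrC NK.
have Nu : N \in unitmx by rewrite unitmxE unitfE.
split => // i j; rewrite /invmx Nu mxE.
have := adjN (i, j) => /= /ltW h.
rewrite /B (bigD1 i)//= (bigD1 j)//= -addrA.
apply: (@le_trans _ _ (`|(\det K)^-1 * (\adj K) i j| + 1)).
  by rewrite -lerBlDl (le_trans _ h)// lerB_dist.
rewrite lerDl addr_ge0//.
  by apply: sumr_ge0 => ? _; rewrite addr_ge0.
by do 2 (apply: sumr_ge0 => ? _); rewrite addr_ge0.
Qed.

(* The infimum of a set without one is [0], so [0 < c] excludes this case. *)
Lemma ge_lambda_min d (M : 'M[R]_d) (c : R) : 0 < c -> c <= lambda_min M ->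
  forall a, eigenvalue M a -> c <= a.
Proof.
move=> c0 cM a Ma; have [hi|nhi] := pselect (has_inf [set a | eigenvalue M a]).
  by apply: (le_trans cM); apply: ge_inf => //; case: hi.
by move: cM; rewrite /lambda_min inf_out// leNgt c0.
Qed.

Lemma trmx_Hmx n d (X : 'M[R]_(n, d)) : (Hmx X)^T = Hmx X.
Proof. by rewrite /Hmx linearZ/= trmx_mul trmxK. Qed.

(** If [v] is in the left kernel, then 0 = |v X^T|^2 / n + lam |v|^2, which forces [v = 0]. This
    gives invertibility at every sample size with positive penalty, as the covariance claims
    require, and not only for large [n]. *)
Lemma ridge_unit n d (X : 'M[R]_(n, d)) (lam : R) : 0 < lam ->
  Hmx X + lam%:M \in unitmx.
Proof.
move=> lam0; rewrite -row_free_unit; apply/inj_row_free => v vM0.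
have sq k (u : 'rV[R]_k) : (u *m u^T) 0 0 = \sum_j u 0 j ^+ 2.
  by rewrite mxE; apply: eq_bigr => j _; rewrite mxE.
have : (v *m (Hmx X + lam%:M) *m v^T) 0 0 = 0 by rewrite vM0 mul0mx mxE.
rewrite mulmxDr mulmxDl mul_mx_scalar -scalemxAl /Hmx -scalemxAr -scalemxAl.
have -> : v *m (X^T *m X) *m v^T = (v *m X^T) *m (v *m X^T)^T.
  by rewrite trmx_mul trmxK !mulmxA.
rewrite mxE [X in X + _]mxE [X in _ + X]mxE !sq => /eqP; rewrite paddr_eq0;
  last 2 first.
- by rewrite mulr_ge0 ?invr_ge0// sumr_ge0// => j _; exact: sqr_ge0.
- by rewrite mulr_ge0 ?(ltW lam0)// sumr_ge0// => j _; exact: sqr_ge0.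
move=> /andP[_]; rewrite mulf_eq0 (gt_eqF lam0)/= psumr_eq0; last first.
  by move=> j _; exact: sqr_ge0.
move=> /allP v0; apply/rowP => j; rewrite mxE; apply/eqP.
by have := v0 j (mem_index_enum _); rewrite sqrf_eq0.
Qed.

End MatrixLemmas.

(** * The sketched ridge estimator *)

(** The pattern in which the normal equation is used twice below: [r] stands for H beta and [s] for
    lam beta, up to a common factor, so that [r + s] is the corresponding multiple of g. *)
Lemma subr_cancel (V : zmodType) (p q r s : V) :
  p - (r + s) - (q - r) = p - q - s.
Proof. by rewrite opprB [r + s]addrC opprD !addrA subrK addrAC. Qed.

Section RidgeAlgebra.
Context {R : realType} {n d : nat}.
Variables (X : 'M[R]_(n, d)) (y : 'cV[R]_n) (lam : R).
Hypothesis Mu : Hmx X + lam%:M \in unitmx.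

Lemma ridge_normal_eq : Hmx X *m beta X y lam + lam *: beta X y lam = gvec X y.
Proof.
by rewrite -mul_scalar_mx -mulmxDl /beta /Amx mulmxA mulmxV// mul1mx.
Qed.

(** Subtracting the normal equation makes psi linear in the two centred statistics [u z - g] and
    [z z^T - H], whose moments the hypotheses control. *)
Lemma psi_score (t : n.-tuple R) : psi X y lam t = Amx X lam *m
  ((urow y t *: zrow X t - gvec X y)
   - (zrow X t *m (zrow X t)^T - Hmx X) *m beta X y lam).
Proof.
rewrite /psi; congr (_ *m _).
rewrite -{1}ridge_normal_eq mulmxBl -mulmxA.
rewrite [X in _ - (_ *m X - _)]mx11_scalar mul_mx_scalar scalerBl.
by rewrite subr_cancel.
Qed.

Lemma sum_psi m (t : 'I_m -> n.-tuple R) : (0 < m)%N ->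
  \sum_i psi X y lam (t i) = m%:R *: (Amx X lam *m
    (ghat X y t - (Hhat X t + lam%:M) *m beta X y lam)).
Proof.
move=> m0; have m0' : m%:R != 0 :> R by rewrite pnatr_eq0 -lt0n.
set b := beta X y lam; set A := Amx X lam.
have -> : \sum_i psi X y lam (t i) = A *m \sum_i
    ((urow y (t i) *: zrow X (t i) - gvec X y)
     - (zrow X (t i) *m (zrow X (t i))^T - Hmx X) *m b).
  by rewrite mulmx_sumr; apply: eq_bigr => i _; exact: psi_score.
rewrite scalemxAr; congr (_ *m _).
rewrite /ghat /Hhat.
set uz := fun i => urow y (t i) *: zrow X (t i).
set zz := fun i => zrow X (t i) *m (zrow X (t i))^T.
have -> : \sum_i ((uz i - gvec X y) - (zz i - Hmx X) *m b) =
    (\sum_i uz i - m%:R *: gvec X y) - (\sum_i zz i - m%:R *: Hmx X) *m b.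
  rewrite sumrB; congr (_ - _).
    by rewrite sumrB sumr_const card_ord scaler_nat.
  rewrite -mulmx_suml; congr (_ *m _).
  by rewrite sumrB sumr_const card_ord scaler_nat.
have -> : m%:R *: (m%:R^-1 *: \sum_i uz i - (m%:R^-1 *: (\sum_i zz i) + lam%:M)
  *m b) =
    \sum_i uz i - (\sum_i zz i) *m b - m%:R *: (lam *: b).
  rewrite scalerBr [X in X - _]scalerA mulfV// scale1r -addrA -opprD.
  congr (_ - _); rewrite mulmxDl mul_scalar_mx scalerDr -scalemxAl.
  by rewrite [X in X + _]scalerA mulfV// scale1r.
rewrite mulmxBl -scalemxAl -ridge_normal_eq -/b scalerDr.
exact: subr_cancel.
Qed.

(* The remainder is the sampling error of [Hhat] times the leading sum; no
   Taylor expansion of the inverse is needed. *)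
Lemma betahat_expansion m (t : 'I_m -> n.-tuple R) : (0 < m)%N ->
  Hhat X t + lam%:M \in unitmx ->
  Num.sqrt m%:R *: (betahat X y lam t - beta X y lam)
    - (Num.sqrt m%:R)^-1 *: \sum_(i < m) psi X y lam (t i) =
  invmx (Hhat X t + lam%:M) *m ((Hmx X - Hhat X t) *m
    ((Num.sqrt m%:R)^-1 *: \sum_(i < m) psi X y lam (t i))).
Proof.
move=> m0 hu; set q := Num.sqrt m%:R.
have sm : q ^+ 2 = m%:R by rewrite sqr_sqrtr.
have sm0 : q != 0 by rewrite sqrtr_eq0 -ltNge ltr0n.
have -> : q^-1 *: \sum_i psi X y lam (t i) = q *: (Amx X lam *m
    (ghat X y t - (Hhat X t + lam%:M) *m beta X y lam)).
  by rewrite sum_psi// -sm scalerA expr2 mulKf.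
rewrite -!scalemxAr -scalerBr; congr (_ *: _).
(* The leading sum is [q A e] and the estimation error is Mhat^-1 e, so the claim reduces to the
   resolvent identity Mhat^-1 - M^-1 = Mhat^-1 (M - Mhat) M^-1 applied to [e]. *)
set e := ghat X y t - _; set Mh := Hhat X t + lam%:M.
have <- : invmx Mh *m e = betahat X y lam t - beta X y lam.
  by rewrite /e /betahat mulmxBr mulKmx.
clearbody e; set M := Hmx X + lam%:M.
have -> : Hmx X - Hhat X t = M - Mh by rewrite opprD addrACA subrr addr0.
have -> : (M - Mh) *m (Amx X lam *m e) = e - Mh *m (Amx X lam *m e).
  by rewrite mulmxBl {1}/Amx mulKVmx.
by rewrite mulmxBr mulKmx.
Qed.

End RidgeAlgebra.

(** * Measurability of matrix operations and of the estimator *)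

Section MeasurableMatrix.
Context {R : realType} d (T : measurableType d).

Definition mxmeasurable p q (M : T -> 'M[R]_(p, q)) :=
  forall i j, measurable_fun setT (fun w => M w i j).

Lemma mxmeasurable_cst p q (A : 'M[R]_(p, q)) : mxmeasurable (fun=> A).
Proof. by move=> i j; exact: measurable_cst. Qed.

Lemma mxmeasurableD p q (M N : T -> 'M[R]_(p, q)) :
  mxmeasurable M -> mxmeasurable N -> mxmeasurable (fun w => M w + N w).
Proof.
by move=> mM mN i j; under eq_fun do rewrite mxE; exact: measurable_funD.
Qed.

Lemma mxmeasurableN p q (M : T -> 'M[R]_(p, q)) :
  mxmeasurable M -> mxmeasurable (fun w => - M w).
Proof.
by move=> mM i j; under eq_fun do rewrite mxE; exact: measurable_funN.
Qed.

Lemma mxmeasurableZ p q (a : T -> R) (M : T -> 'M[R]_(p, q)) :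
  measurable_fun setT a -> mxmeasurable M -> mxmeasurable (fun w => a w *: M w).
Proof.
by move=> ma mM i j; under eq_fun do rewrite mxE; exact: measurable_funM.
Qed.

Lemma mxmeasurable_tr p q (M : T -> 'M[R]_(p, q)) :
  mxmeasurable M -> mxmeasurable (fun w => (M w)^T).
Proof. by move=> mM i j; under eq_fun do rewrite mxE; exact: mM. Qed.

Lemma mxmeasurableM p q r (M : T -> 'M[R]_(p, q)) (N : T -> 'M[R]_(q, r)) :
  mxmeasurable M -> mxmeasurable N -> mxmeasurable (fun w => M w *m N w).
Proof.
move=> mM mN i j; under eq_fun do rewrite mxE.
by apply: measurable_sum => k; exact: measurable_funM.
Qed.

Lemma mxmeasurable_sum I (r : seq I) p q (M : I -> T -> 'M[R]_(p, q)) :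
  (forall i, mxmeasurable (M i)) ->
  mxmeasurable (fun w => \sum_(i <- r) M i w).
Proof.
move=> mM i j; under eq_fun do rewrite summxE.
by apply: measurable_sum => k; exact: mM.
Qed.

Lemma measurable_det p (M : T -> 'M[R]_p) :
  mxmeasurable M -> measurable_fun setT (fun w => \det (M w)).
Proof.
move=> mM; apply: measurable_sum => s; apply: measurable_funM => //.
by apply: measurable_prod => i _; exact: mM.
Qed.

(** Inversion is continuous on the open complement of 0, and the remaining set is a single point. *)
Lemma measurable_inv (f : T -> R) :
  measurable_fun setT f -> measurable_fun setT (fun w => (f w)^-1).
Proof.
move=> mf; apply: (measurableT_comp _ mf).
rewrite -(setUv [set (0 : R)]); apply/measurable_funU => //.
  exact: measurableC.
split; first exact: measurable_fun_set1.
apply: open_continuous_measurable_fun.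
  exact/closed_openC/closed_eq.
by move=> x; rewrite inE/= => /eqP x0; exact: inv_continuous.
Qed.

(** [invmx] is the identity on singular matrices, so the function is glued from two measurable
    branches along the vanishing of the determinant. *)
Lemma mxmeasurable_inv p (M : T -> 'M[R]_p) :
  mxmeasurable M -> mxmeasurable (fun w => invmx (M w)).
Proof.
move=> mM i j; rewrite /invmx.
have -> : (fun w => (if M w \in unitmx then (\det (M w))^-1 *: \adj (M w)
    else M w) i j) = (fun w => if ~~ (\det (M w) == 0) then
    (\det (M w))^-1 * (\adj (M w)) i j else M w i j).
  apply/funext => w; rewrite unitmxE unitfE.
  by case: ifP => _ //; rewrite mxE.
have mdet := measurable_det mM.
apply: measurable_fun_ifT => //.
  by apply: measurable_neg; exact: measurable_fun_eqr.
apply: measurable_funM; first exact: measurable_inv.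
under eq_fun do rewrite mxE; apply: measurable_funM => //.
apply: measurable_det => k l; under eq_fun do rewrite !mxE; exact: mM.
Qed.

End MeasurableMatrix.

Section RidgeMeasurable.
Context {R : realType} {n d : nat}.
Variables (X : 'M[R]_(n, d)) (y : 'cV[R]_n) (lam : R).
Context disp (T : measurableType disp).

Lemma mxmeasurable_tcol (S : T -> n.-tuple R) : measurable_fun setT S ->
  mxmeasurable (fun w => tcol (S w)).
Proof.
move=> mS i j; rewrite /tcol; under eq_fun do rewrite mxE.
exact: (measurableT_comp (measurable_tnth i) mS).
Qed.

Lemma mxmeasurable_zrow (S : T -> n.-tuple R) : measurable_fun setT S ->
  mxmeasurable (fun w => zrow X (S w)).
Proof.
move=> mS; apply: mxmeasurableZ => //; apply: mxmeasurableM.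
  exact: mxmeasurable_cst.
exact: mxmeasurable_tcol.
Qed.

Lemma measurable_urow (S : T -> n.-tuple R) : measurable_fun setT S ->
  measurable_fun setT (fun w => urow y (S w)).
Proof.
move=> mS; apply: measurable_funM => //.
have : mxmeasurable (fun w => y^T *m tcol (S w)).
  by apply: mxmeasurableM; [exact: mxmeasurable_cst|exact: mxmeasurable_tcol].
exact.
Qed.

Lemma mxmeasurable_outer (S : T -> n.-tuple R) : measurable_fun setT S ->
  mxmeasurable (fun w => zrow X (S w) *m (zrow X (S w))^T).
Proof.
move=> mS; apply: mxmeasurableM; first exact: mxmeasurable_zrow.
exact/mxmeasurable_tr/mxmeasurable_zrow.
Qed.

Lemma mxmeasurable_uz (S : T -> n.-tuple R) : measurable_fun setT S ->
  mxmeasurable (fun w => urow y (S w) *: zrow X (S w)).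
Proof.
move=> mS; apply: mxmeasurableZ; first exact: measurable_urow.
exact: mxmeasurable_zrow.
Qed.

Lemma mxmeasurable_psi (S : T -> n.-tuple R) : measurable_fun setT S ->
  mxmeasurable (fun w => psi X y lam (S w)).
Proof.
move=> mS; rewrite /psi; apply: mxmeasurableM; first exact: mxmeasurable_cst.
apply: mxmeasurableD; last exact: mxmeasurable_cst.
apply: mxmeasurableZ; last exact: mxmeasurable_zrow.
apply: measurable_funB; first exact: measurable_urow.
have : mxmeasurable (fun w => (zrow X (S w))^T *m beta X y lam).
  apply: mxmeasurableM; last exact: mxmeasurable_cst.
  exact/mxmeasurable_tr/mxmeasurable_zrow.
exact.
Qed.

Context (m : nat) (S : 'I_m -> T -> n.-tuple R).
Hypothesis mS : forall i, measurable_fun setT (S i).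

Lemma mxmeasurable_Hhat : mxmeasurable (fun w => Hhat X (fun i => S i w)).
Proof.
apply: mxmeasurableZ => //; apply: mxmeasurable_sum => i.
exact: mxmeasurable_outer.
Qed.

Lemma mxmeasurable_betahat :
  mxmeasurable (fun w => betahat X y lam (fun i => S i w)).
Proof.
apply: mxmeasurableM.
  apply: mxmeasurable_inv; apply: mxmeasurableD; last exact: mxmeasurable_cst.
  exact: mxmeasurable_Hhat.
apply: mxmeasurableZ => //; apply: mxmeasurable_sum => i.
exact: mxmeasurable_uz.
Qed.

Lemma mxmeasurable_remainder : mxmeasurable (fun w =>
  Num.sqrt m%:R *: (betahat X y lam (fun i => S i w) - beta X y lam)
  - (Num.sqrt m%:R)^-1 *: \sum_(i < m) psi X y lam (S i w)).
Proof.
apply: mxmeasurableD.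
  apply: mxmeasurableZ => //; apply: mxmeasurableD.
    exact: mxmeasurable_betahat.
  exact: mxmeasurable_cst.
apply: mxmeasurableN; apply: mxmeasurableZ => //.
by apply: mxmeasurable_sum => i; exact: mxmeasurable_psi.
Qed.

End RidgeMeasurable.

(** * Inequalities between norms and entries *)

Section NormLemmas.
Context {R : realType}.

Lemma normF4 p q (M : 'M[R]_(p, q)) :
  normF M ^+ 4 = (\sum_i \sum_j M i j ^+ 2) ^+ 2.
Proof.
rewrite (exprM _ 2 2) sqr_sqrtr//.
by do 2 (apply: sumr_ge0 => ? _); exact: sqr_ge0.
Qed.

Lemma norm24 p (v : 'cV[R]_p) : norm2 v ^+ 4 = (\sum_i v i 0 ^+ 2) ^+ 2.
Proof.
by rewrite (exprM _ 2 2) sqr_sqrtr// sumr_ge0// => i _; exact: sqr_ge0.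
Qed.

(** A squared entry is at most the squared norm [s], and [s <= 1 + s^2]. Fourth moments of the norm
    thus control second moments of the entries. *)
Lemma coord_le_normF4 p q (M : 'M[R]_(p, q)) a b :
  M a b ^+ 2 <= 1 + normF M ^+ 4.
Proof.
rewrite normF4; set s := \sum_i _.
have : M a b ^+ 2 <= s.
  rewrite /s (bigD1 a)//= (bigD1 b)//= -addrA lerDl addr_ge0//.
    by rewrite sumr_ge0// => ? _; exact: sqr_ge0.
  by do 2 (apply: sumr_ge0 => ? _); exact: sqr_ge0.
by have := sqr_ge0 (s - 1); nra.
Qed.

Lemma coord_le_norm24 p (v : 'cV[R]_p) a : v a 0 ^+ 2 <= 1 + norm2 v ^+ 4.
Proof.
rewrite norm24; set s := \sum_i _.
have : v a 0 ^+ 2 <= s.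
  by rewrite /s (bigD1 a)//= lerDl sumr_ge0// => ? _; exact: sqr_ge0.
by have := sqr_ge0 (s - 1); nra.
Qed.

Lemma norm2_le_sum p (v : 'cV[R]_p) : norm2 v <= \sum_i `|v i 0|.
Proof.
rewrite -[leRHS]ger0_norm ?sumr_ge0// -sqrtr_sqr ler_wsqrtr//.
rewrite expr2 big_distrlr/=; apply: ler_sum => i _.
rewrite (bigD1 i)//= -expr2 real_normK ?num_real// lerDl.
by apply: sumr_ge0 => j _; exact: mulr_ge0.
Qed.

(** Removes the square root, so that exceedance events are visibly measurable. *)
Lemma ltr_norm2 p (v : 'cV[R]_p) (e : R) : 0 <= e ->
  (e < norm2 v) = (e ^+ 2 < \sum_i v i 0 ^+ 2).
Proof.
move=> e0; have s0 : 0 <= \sum_i v i 0 ^+ 2.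
  by rewrite sumr_ge0// => i _; exact: sqr_ge0.
by rewrite -[in RHS](sqr_sqrtr s0) ltr_pXn2r// nnegrE sqrtr_ge0.
Qed.

End NormLemmas.

(** * Moments of a single sketch row *)

Section RidgeMoments.
Context {R : realType} {n d : nat}.
Variables (X : 'M[R]_(n, d)) (y : 'cV[R]_n) (lam : R).
Context disp (T : measurableType disp) (P : probability T R).
Variable S : T -> n.-tuple R.
Hypothesis mS : measurable_fun setT S.
Hypothesis Siso : forall j k : 'I_n,
  'E_P[fun w => (tcol (S w) *m (tcol (S w))^T) j k]%E =
  ((1%:M : 'M[R]_n) j k)%:E.

Local Notation s j := (fun w => tnth (S w) j).

Let ms j : measurable_fun setT (s j).
Proof. exact: (measurableT_comp (measurable_tnth j) mS). Qed.

Let outerE j k : (fun w => (tcol (S w) *m (tcol (S w))^T) j k) =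
  (fun w => tnth (S w) j * tnth (S w) k).
Proof. by apply/funext => w; rewrite mxE big_ord1 !mxE. Qed.

(** Isotropy is an equality of extended reals, so its diagonal entries already say that the second
    moments are finite. *)
Lemma isotropic_sqint j : sqint P (s j).
Proof.
split=> //; apply/integrableP; split.
  by apply/measurable_EFinP; exact: measurable_funX.
have := Siso j j; rewrite outerE unlock mxE eqxx => E.
under eq_integral do rewrite /= ger0_norm ?sqr_ge0// expr2.
by rewrite E ltry.
Qed.

Lemma isotropic_mean j k :
  mean P (fun w => tnth (S w) j * tnth (S w) k) = (j == k)%:R.
Proof. by have := Siso j k; rewrite outerE /mean => ->; rewrite mxE. Qed.

(** The entries of [z z^T] and [u z] are such products up to the factor [1/n], with columns of [X]
    or [y] as coefficients; their means are therefore those of H and g. *)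
Lemma isotropic_bilinear (v w : 'I_n -> R) :
  integ P (fun x => (\sum_j v j * tnth (S x) j) * (\sum_k w k * tnth (S x) k))
    /\
  mean P (fun x => (\sum_j v j * tnth (S x) j) * (\sum_k w k * tnth (S x) k)) =
  \sum_j v j * w j.
Proof.
have lin (u : 'I_n -> R) : sqint P (fun x => \sum_j u j * tnth (S x) j).
  by apply: sqint_sum => j; apply: sqintZ; exact: isotropic_sqint.
split; first exact: integ_sqintM.
have jk j k : integ P (fun x => v j * w k * (tnth (S x) j * tnth (S x) k)).
  by apply: integZ; apply: integ_sqintM; exact: isotropic_sqint.
have -> : (fun x => (\sum_j v j * tnth (S x) j) * (\sum_k w k * tnth (S x) k)) =
    (fun x => \sum_j \sum_k v j * w k * (tnth (S x) j * tnth (S x) k)).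
  apply/funext => x; rewrite big_distrlr/=; apply: eq_bigr => j _.
  by apply: eq_bigr => k _; rewrite mulrACA.
rewrite mean_sum; last by move=> j; exact: integ_sum.
apply: eq_bigr => j _; rewrite mean_sum// (bigD1 j)//= big1 ?addr0.
  rewrite meanZ ?isotropic_mean ?eqxx ?mulr1//.
  by apply: integ_sqintM; exact: isotropic_sqint.
move=> k kj; rewrite meanZ ?isotropic_mean.
  by rewrite eq_sym (negPf kj) mulr0.
by apply: integ_sqintM; exact: isotropic_sqint.
Qed.

Lemma zrowE (t : n.-tuple R) a :
  zrow X t a 0 = (Num.sqrt n%:R)^-1 * \sum_j X j a * tnth t j.
Proof.
by rewrite !mxE; congr (_ * _); apply: eq_bigr => j _; rewrite !mxE.
Qed.

Lemma urowE (t : n.-tuple R) :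
  urow y t = (Num.sqrt n%:R)^-1 * \sum_j y j 0 * tnth t j.
Proof.
by rewrite /urow mxE; congr (_ * _); apply: eq_bigr => j _; rewrite !mxE.
Qed.

Let sqn : (Num.sqrt n%:R)^-1 * (Num.sqrt n%:R)^-1 = n%:R^-1 :> R.
Proof. by rewrite -invfM -expr2 sqr_sqrtr. Qed.

Lemma mean_outer a b :
  let h w := (zrow X (S w) *m (zrow X (S w))^T - Hmx X) a b in
  integ P h /\ mean P h = 0.
Proof.
have [i1 m1] := isotropic_bilinear (fun j => X j a) (fun k => X k b).
have E : (fun w => (zrow X (S w) *m (zrow X (S w))^T - Hmx X) a b) =
    (fun w => n%:R^-1 * ((\sum_j X j a * tnth (S w) j) *
      (\sum_k X k b * tnth (S w) k)) + - Hmx X a b).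
  apply/funext => w; rewrite mxE [X in X + _]mxE big_ord1 [X in _ * X]mxE
    !zrowE.
  by rewrite mxE mulrACA sqn.
rewrite E /=; split.
  by apply: integD; [exact: integZ|exact: integ_cst].
rewrite meanD ?meanZ ?mean_cst ?m1; [|exact: i1|exact: integZ|exact: integ_cst].
rewrite !mxE; apply/eqP; rewrite subr_eq0; apply/eqP; congr (_ * _).
by apply: eq_bigr => j _; rewrite mxE.
Qed.

Lemma mean_uz a :
  let p w := (urow y (S w) *: zrow X (S w) - gvec X y) a 0 in
  integ P p /\ mean P p = 0.
Proof.
have [i1 m1] := isotropic_bilinear (fun j => y j 0) (fun k => X k a).
have E : (fun w => (urow y (S w) *: zrow X (S w) - gvec X y) a 0) =
    (fun w => n%:R^-1 * ((\sum_j y j 0 * tnth (S w) j) *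
      (\sum_k X k a * tnth (S w) k)) + - gvec X y a 0).
  by apply/funext => w; rewrite mxE [X in X + _]mxE zrowE urowE mxE mulrACA sqn.
rewrite E /=; split.
  by apply: integD; [exact: integZ|exact: integ_cst].
rewrite meanD ?meanZ ?mean_cst ?m1; [|exact: i1|exact: integZ|exact: integ_cst].
rewrite !mxE; apply/eqP; rewrite subr_eq0; apply/eqP; congr (_ * _).
by apply: eq_bigr => j _; rewrite mxE mulrC.
Qed.

Variable K : R.
Hypothesis SK : ('E_P[fun w =>
      let z := zrow X (S w) in
      let u := urow y (S w) in
      (normF (z *m z^T - Hmx X) ^+ 4 +
       norm2 (u *: z - gvec X y) ^+ 4)%R] <= K%:E)%E.

Let Q w := normF (zrow X (S w) *m (zrow X (S w))^T - Hmx X) ^+ 4 +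
  norm2 (urow y (S w) *: zrow X (S w) - gvec X y) ^+ 4.

Let Q_integ : integ P Q /\ mean P Q <= K.
Proof.
have mQ : measurable_fun setT Q.
  have mh : mxmeasurable (fun w => zrow X (S w) *m (zrow X (S w))^T - Hmx X).
    by apply: mxmeasurableD; [exact: mxmeasurable_outer|exact:
      mxmeasurable_cst].
  have mp : mxmeasurable (fun w => urow y (S w) *: zrow X (S w) - gvec X y).
    by apply: mxmeasurableD; [exact: mxmeasurable_uz|exact: mxmeasurable_cst].
  apply: measurable_funD.
    under eq_fun do rewrite normF4.
    apply: measurable_funX; apply: measurable_sum => i.
    by apply: measurable_sum => j; apply: measurable_funX; exact: mh.
  under eq_fun do rewrite norm24.
  apply: measurable_funX; apply: measurable_sum => i.
  by apply: measurable_funX; exact: mp.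
have Q0 w : 0 <= Q w by rewrite addr_ge0// exprn_ge0// sqrtr_ge0.
have iQ : integ P Q.
  apply/integrableP; split; first exact/measurable_EFinP.
  under eq_integral do rewrite /= ger0_norm//.
  by move: SK; rewrite unlock => /le_lt_trans; apply; exact: ltry.
by split => //; rewrite -lee_fin -mean_EFin.
Qed.

Let sqint_le_Q (h : T -> R) : measurable_fun setT h ->
  (forall w, h w ^+ 2 <= 1 + Q w) ->
  sqint P h /\ mean P (fun w => h w ^+ 2) <= 1 + K.
Proof.
move=> mh hQ; have [iQ QK] := Q_integ.
have i1Q : integ P (fun w => 1 + Q w) by apply: integD => //; exact: integ_cst.
have ih : integ P (fun w => h w ^+ 2).
  apply: (integ_le _ _ i1Q); first exact: measurable_funX.
  by move=> w; rewrite ger0_norm ?sqr_ge0.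
split => //; apply: (le_trans (le_mean ih i1Q hQ)).
by rewrite meanD ?mean_cst ?lerD2l//; exact: integ_cst.
Qed.

Lemma sqint_outer a b :
  let h w := (zrow X (S w) *m (zrow X (S w))^T - Hmx X) a b in
  sqint P h /\ mean P (fun w => h w ^+ 2) <= 1 + K.
Proof.
apply: sqint_le_Q => [|w].
  have : mxmeasurable (fun w => zrow X (S w) *m (zrow X (S w))^T - Hmx X).
    by apply: mxmeasurableD; [exact: mxmeasurable_outer|exact:
      mxmeasurable_cst].
  exact.
apply: (le_trans (coord_le_normF4 _ a b)); rewrite lerD2l lerDl.
by rewrite exprn_ge0// sqrtr_ge0.
Qed.

Lemma sqint_uz a :
  sqint P (fun w => (urow y (S w) *: zrow X (S w) - gvec X y) a 0).
Proof.
apply: (sqint_le_Q _ _).1 => [|w].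
  have : mxmeasurable (fun w => urow y (S w) *: zrow X (S w) - gvec X y).
    by apply: mxmeasurableD; [exact: mxmeasurable_uz|exact: mxmeasurable_cst].
  exact.
apply: (le_trans (coord_le_norm24 _ a)); rewrite lerD2l lerDr.
by rewrite exprn_ge0// sqrtr_ge0.
Qed.

Hypothesis Mu : Hmx X + lam%:M \in unitmx.

Lemma sqint_psi k : sqint P (fun w => psi X y lam (S w) k 0).
Proof.
under eq_fun do rewrite psi_score// mxE.
apply: sqint_sum => a; apply: sqintZ; under eq_fun do rewrite mxE.
apply: sqintD; first exact: sqint_uz.
under eq_fun do rewrite mxE -mulN1r mxE.
apply: sqintZ; apply: sqint_sum => b; under eq_fun do rewrite mulrC.
by apply: sqintZ; have [] := sqint_outer a b.
Qed.

Lemma mean_psi k : mean P (fun w => psi X y lam (S w) k 0) = 0.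
Proof.
have ip a := (mean_uz a).1; have ih a b := (mean_outer a b).1.
have ihb a : integ P (fun w => -1 * \sum_b beta X y lam b 0 *
    (zrow X (S w) *m (zrow X (S w))^T - Hmx X) a b).
  by apply: integZ; apply: integ_sum => b; exact: integZ.
under eq_fun do rewrite psi_score// mxE.
have E a : (fun w => Amx X lam k a * (urow y (S w) *: zrow X (S w) - gvec X y
      - (zrow X (S w) *m (zrow X (S w))^T - Hmx X) *m beta X y lam) a 0) =
    (fun w => Amx X lam k a * ((urow y (S w) *: zrow X (S w) - gvec X y) a 0 +
      -1 * \sum_b beta X y lam b 0 *
        (zrow X (S w) *m (zrow X (S w))^T - Hmx X) a b)).
  apply/funext => w; congr (_ * _); rewrite mxE; congr (_ + _).
  rewrite mxE mulN1r mxE; congr (- _).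
  by apply: eq_bigr => b _; rewrite mulrC.
rewrite mean_sum; last by move=> a; rewrite E; apply: integZ; exact: integD.
apply: big1 => a _; rewrite E meanZ; last exact: integD.
rewrite meanD// (mean_uz a).2 meanZ; last first.
  by apply: integ_sum => b; exact: integZ.
rewrite mean_sum; last by move=> b; exact: integZ.
rewrite big1 ?mulr0 ?addr0 ?mulr0// => b _.
by rewrite meanZ// (mean_outer a b).2 mulr0.
Qed.

End RidgeMoments.

(** * Closed form of Omega for independent coordinates *)

Section IndependentCoordinates.
Context {R : realType} {n d : nat}.
Variables (X : 'M[R]_(n, d)) (y : 'cV[R]_n) (lam : R).
Context disp (T : measurableType disp) (P : probability T R).
Variable S : T -> n.-tuple R.
Hypothesis mS : measurable_fun setT S.
Hypothesis Mu : Hmx X + lam%:M \in unitmx.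

Lemma mean_mx_congr p q (B : 'M[R]_(p, q)) (v : T -> 'cV[R]_q) :
  (forall a b, integ P (fun w => v w a 0 * v w b 0)) ->
  mean_mx P (fun w => (B *m v w) *m (B *m v w)^T) =
  B *m (\matrix_(a, b) mean P (fun w => v w a 0 * v w b 0)) *m B^T.
Proof.
move=> iv; apply/matrixP => k l; rewrite mxE -/(mean P _).
have -> : (fun w => ((B *m v w) *m (B *m v w)^T) k l) = (fun w =>
    \sum_b \sum_a (B k a * B l b) * (v w a 0 * v w b 0)).
  apply/funext => w; rewrite mxE big_ord1 [X in _ * X]mxE [X in X * _]mxE [X in
    _ * X]mxE.
  rewrite big_distrlr/= exchange_big/=; apply: eq_bigr => b _.
  by apply: eq_bigr => a _; rewrite mulrACA.
rewrite mean_sum; last by move=> b; apply: integ_sum => a; exact: integZ.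
rewrite [RHS]mxE; apply: eq_bigr => b _.
rewrite mean_sum; last by move=> a; exact: integZ.
rewrite mxE big_distrl/=; apply: eq_bigr => a _.
by rewrite meanZ// !mxE mulrAC.
Qed.

Let b := beta X y lam.
Let r := resid X y lam.

(** The normal equation in residual form. It is the origin of the term [lam^2 beta beta^T] in
    Omega. *)
Lemma shrinkage_resid a : lam * b a 0 = n%:R^-1 * \sum_j X j a * r j 0.
Proof.
have : lam *: b = n%:R^-1 *: (X^T *m r).
  have -> : lam *: b = gvec X y - Hmx X *m b.
    by apply/eqP; rewrite eq_sym subr_eq addrC eq_sym;
      apply/eqP/ridge_normal_eq.
  by rewrite [RHS](_ : _ = n%:R^-1 *: (X^T *m y) - (n%:R^-1 *: (X^T *m X)) *m
    b)//
    -scalemxAl -mulmxA -scalerBr -mulmxBr.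
move=> /matrixP/(_ a 0); rewrite !mxE => ->; congr (_ * _).
by apply: eq_bigr => j _; rewrite mxE.
Qed.

Let q (t : n.-tuple R) : 'cV[R]_d :=
  (urow y t - ((zrow X t)^T *m b) 0 0) *: zrow X t - lam *: b.

(** The sketched residual [u - z^T beta] is r^T s / sqrt n, and the shrinkage term supplies the
    identity subtracted from s s^T. *)
Lemma score_resid (t : n.-tuple R) a : q t a 0 = n%:R^-1 *
  \sum_j \sum_k X j a * r k 0 * (tnth t j * tnth t k - (j == k)%:R).
Proof.
have sqn : (Num.sqrt n%:R)^-1 * (Num.sqrt n%:R)^-1 = n%:R^-1 :> R.
  by rewrite -invfM -expr2 sqr_sqrtr.
have ur : urow y t - ((zrow X t)^T *m b) 0 0 =
    (Num.sqrt n%:R)^-1 * \sum_k r k 0 * tnth t k.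
  have -> : ((zrow X t)^T *m b) 0 0 =
      (Num.sqrt n%:R)^-1 * \sum_k (X *m b) k 0 * tnth t k.
    rewrite mxE; under eq_bigr do rewrite mxE zrowE -mulrA mulr_suml.
    rewrite -mulr_sumr exchange_big/=; congr (_ * _); apply: eq_bigr => k _.
    by rewrite mxE mulr_suml; apply: eq_bigr => c _; rewrite mulrAC.
  rewrite urowE -mulrBr -sumrB; congr (_ * _); apply: eq_bigr => k _.
  by rewrite -mulrBl /r /resid [in RHS]mxE [in RHS]mxE.
rewrite /q mxE [X in X + _]mxE ur zrowE mxE [X in _ - X]mxE shrinkage_resid.
rewrite mulrACA sqn -mulrBr; congr (_ * _).
rewrite mulrC big_distrlr/= -sumrB; apply: eq_bigr => j _.
transitivity (\sum_k (X j a * tnth t j * (r k 0 * tnth t k) -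
    X j a * r k 0 * (j == k)%:R)).
  rewrite sumrB; congr (_ - _); rewrite (bigD1 j)//= eqxx mulr1 big1 ?addr0//.
  by move=> k kj; rewrite eq_sym (negPf kj) mulr0.
by apply: eq_bigr => k _; ring.
Qed.

Context d0 (T0 : measurableType d0) (P0 : probability T0 R) (s : T0 -> R).
Hypothesis ms : measurable_fun setT s.
Hypothesis s1 : mean P0 s = 0.
Hypothesis s2 : mean P0 (fun w => s w ^+ 2) = 1.
Hypothesis s4 : integ P0 (fun w => s w ^+ 4).
Hypothesis indS : mutually_independent P (fun (j : 'I_n) w => tnth (S w) j).
Hypothesis lawS : forall j, same_law P P0 (fun w => tnth (S w) j) s.

Let kappa := mean P0 (fun w => s w ^+ 4) - 3.

Let mS_ j : measurable_fun setT (fun w => tnth (S w) j).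
Proof. exact: (measurableT_comp (measurable_tnth j) mS). Qed.

Let sum_delta (I : finType) (i : I) (F : I -> R) :
  \sum_j F j * (i == j)%:R = F i.
Proof.
rewrite (bigD1 i)//= eqxx mulr1 big1 ?addr0// => j ji.
by rewrite eq_sym (negPf ji) mulr0.
Qed.

(** Centring s_j s_k and s_l s_p removes the pairing j = k, l = p from Wick's formula. The other two
    pairings contract to the |r|^2 term and to the product of entries of X^T r; the kurtosis
    correction keeps the full diagonal. *)
Lemma mean_scoreM a c :
  integ P (fun w => q (S w) a 0 * q (S w) c 0) /\
  mean P (fun w => q (S w) a 0 * q (S w) c 0) = n%:R ^- 2 *
    ((\sum_j X j a * X j c) * (\sum_k r k 0 ^+ 2)
     + (\sum_j X j a * r j 0) * (\sum_k X k c * r k 0)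
     + kappa * \sum_j X j a * (r j 0 * r j 0) * X j c).
Proof.
pose M j k l p w := (tnth (S w) j * tnth (S w) k - (j == k)%:R) *
  (tnth (S w) l * tnth (S w) p - (l == p)%:R).
have ME j k l p : integ P (M j k l p) /\ mean P (M j k l p) =
    ((j == l) && (k == p))%:R + ((j == p) && (k == l))%:R
    + kappa * [&& j == k, j == l & j == p]%:R.
  have i2 j' k' := integ_mul2 mS_ ms lawS s4 j' k'.
  have m2 j' k' := mean_mul2 mS_ indS ms lawS s1 s2 s4 j' k'.
  have i4 := integ_mul4 mS_ ms lawS s4 j k l p.
  have -> : M j k l p = (fun w =>
      (tnth (S w) j * tnth (S w) k * (tnth (S w) l * tnth (S w) p)
      + - (l == p)%:R * (tnth (S w) j * tnth (S w) k))
      + (- (j == k)%:R * (tnth (S w) l * tnth (S w) p)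
      + (j == k)%:R * (l == p)%:R)).
    by apply/funext => w; rewrite /M; ring.
  have iA : integ P (fun w =>
      tnth (S w) j * tnth (S w) k * (tnth (S w) l * tnth (S w) p)
      + - (l == p)%:R * (tnth (S w) j * tnth (S w) k)).
    by apply: integD => //; exact: integZ.
  have iB : integ P (fun w => - (j == k)%:R * (tnth (S w) l * tnth (S w) p)
      + (j == k)%:R * (l == p)%:R).
    by apply: integD; [exact: integZ|exact: integ_cst].
  split; first exact: integD.
  rewrite meanD// meanD//; last exact: integZ.
  rewrite meanD; [|exact: integZ|exact: integ_cst].
  rewrite mean_cst !meanZ// !m2 (mean_mul4 mS_ indS ms lawS s1 s2 s4).
  by rewrite -!mulnb !natrM /kappa; ring.
pose F j k l p := X j a * r k 0 * (X l c * r p 0).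
have E : (fun w => q (S w) a 0 * q (S w) c 0) = (fun w => n%:R ^- 2 *
    \sum_j \sum_k \sum_l \sum_p F j k l p * M j k l p w).
  apply/funext => w; rewrite !score_resid mulrACA -invfM -expr2; congr (_ * _).
  rewrite big_distrl/=; apply: eq_bigr => j _.
  rewrite big_distrl/=; apply: eq_bigr => k _.
  rewrite big_distrr/=; apply: eq_bigr => l _.
  rewrite big_distrr/=; apply: eq_bigr => p _.
  by rewrite /F /M mulrACA.
have i4 j k l p : integ P (fun w => F j k l p * M j k l p w).
  by apply: integZ; have [] := ME j k l p.
have i3 j k l : integ P (fun w => \sum_p F j k l p * M j k l p w).
  exact: integ_sum.
have i2 j k : integ P (fun w => \sum_l \sum_p F j k l p * M j k l p w).
  exact: integ_sum.
have i1 j : integ P (fun w => \sum_k \sum_l \sum_p F j k l p * M j k l p w).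
  exact: integ_sum.
rewrite E; split; first by apply: integZ; exact: integ_sum.
rewrite meanZ; last exact: integ_sum.
congr (_ * _); rewrite mean_sum//.
transitivity (\sum_j ((\sum_k F j k j k) + (\sum_k F j k k j) + kappa * F j j j
  j)).
  apply: eq_bigr => j _; rewrite mean_sum//.
  (* The diagonal term is spread over [k] by a Kronecker delta, so that all three contractions can
     be compared for fixed [j] and [k]. *)
  rewrite -[kappa * _](sum_delta j (fun k => kappa * F j k k k)).
  rewrite -!big_split/=; apply: eq_bigr => k _; rewrite mean_sum//.
  transitivity (\sum_l \sum_p (F j k l p * ((j == l)%:R * (k == p)%:R)
     + F j k l p * ((j == p)%:R * (k == l)%:R)
     + kappa * F j k l p * ((j == k)%:R * (j == l)%:R * (j == p)%:R))).
    apply: eq_bigr => l _; rewrite mean_sum//; apply: eq_bigr => p _.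
    rewrite meanZ; last by have [] := ME j k l p.
    have [_ ->] := ME j k l p.
    by rewrite -!mulnb !natrM; ring.
  under eq_bigr do rewrite !big_split/=.
  rewrite !big_split/=; congr (_ + _ + _).
  - transitivity (\sum_l F j k l k * (j == l)%:R); last exact: sum_delta.
    apply: eq_bigr => l _; rewrite -(sum_delta k (fun p => F j k l p * (j ==
      l)%:R)).
    by apply: eq_bigr => p _; ring.
  - transitivity (\sum_l F j k l j * (k == l)%:R); last exact: sum_delta.
    apply: eq_bigr => l _; rewrite -(sum_delta j (fun p => F j k l p * (k ==
      l)%:R)).
    by apply: eq_bigr => p _; ring.
  - transitivity (\sum_l (kappa * F j k l j * (j == k)%:R) * (j == l)%:R).
      apply: eq_bigr => l _.
      rewrite -(sum_delta j (fun p => kappa * F j k l p * (j == k)%:R * (j ==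
        l)%:R)).
      by apply: eq_bigr => p _; ring.
    rewrite sum_delta; have [->//|] := eqVneq j k.
    by rewrite !mulr0.
rewrite !big_split/= -mulr_sumr; congr (_ + _ + _ * _).
- rewrite big_distrlr/=; apply: eq_bigr => j _; apply: eq_bigr => k _.
  by rewrite /F; ring.
- rewrite big_distrlr/=; apply: eq_bigr => j _; apply: eq_bigr => k _.
  by rewrite /F; ring.
- by apply: eq_bigr => j _; rewrite /F; ring.
Qed.

Lemma Omega_independent_coordinates :
  Omega P X y lam S = Amx X lam *m ((norm2 r ^+ 2 / n%:R) *: Hmx X
    + lam ^+ 2 *: (b *m b^T) + (kappa / n%:R ^+ 2) *:
      (X^T *m diag_mx (\row_j (r j 0 * r j 0)) *m X)) *m (Amx X lam)^T.
Proof.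
rewrite /Omega /psi -/b -/(q _) mean_mx_congr => [|a c]; last first.
  by have [] := mean_scoreM a c.
congr (_ *m _ *m _); apply/matrixP => a c; rewrite mxE.
have [_ ->] := mean_scoreM a c.
rewrite mxE [X in _ = X + _]mxE [X in _ = X + _ + _]mxE [X in _ = _ + X + _]mxE.
rewrite [X in _ = _ + X]mxE.
have -> : norm2 r ^+ 2 = \sum_k r k 0 ^+ 2.
  by rewrite sqr_sqrtr// sumr_ge0// => k _; exact: sqr_ge0.
have -> : Hmx X a c = n%:R^-1 * \sum_j X j a * X j c.
  by rewrite !mxE; congr (_ * _); apply: eq_bigr => j _; rewrite mxE.
have -> : lam ^+ 2 * (b *m b^T) a c = (lam * b a 0) * (lam * b c 0).
  by rewrite mxE big_ord1 [b^T _ _]mxE expr2 mulrACA.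
have -> : (X^T *m diag_mx (\row_j (r j 0 * r j 0)) *m X) a c =
    \sum_j X j a * (r j 0 * r j 0) * X j c.
  rewrite mul_mx_diag mxE; apply: eq_bigr => j _; by rewrite !mxE.
rewrite !shrinkage_resid -exprVn; ring.
Qed.

End IndependentCoordinates.

(** * Covariances and remainder bound at a fixed sample size *)

Section Covariance.
Context {R : realType} disp (T : measurableType disp) (P : probability T R).

Lemma centered_covariance d (V : T -> 'cV[R]_d) (C : 'M[R]_d) :
  (forall k, sqint P (fun w => V w k 0)) ->
  (forall k, mean P (fun w => V w k 0) = 0) ->
  (forall k l, mean P (fun w => V w k 0 * V w l 0) = C k l) ->
  has_covariance P V C.
Proof.
move=> sV V0 VC k l; rewrite covariance.unlock.
have V0' j : fine ('E_P[(fun w => V w j 0)%R])%E = 0 by exact: V0.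
rewrite !V0' -VC -mean_EFin; last exact: integ_sqintM.
congr ('E_P[_])%E; apply/funext => w.
by change ((V w k 0 - 0) * (V w l 0 - 0) = V w k 0 * V w l 0); rewrite !subr0.
Qed.

End Covariance.

Section FiniteSample.
Context {R : realType} {n d m : nat}.
Variables (X : 'M[R]_(n, d)) (y : 'cV[R]_n) (lam : R).
Context disp (T : measurableType disp) (P : probability T R).
Variable S : 'I_m -> T -> n.-tuple R.
Hypothesis mS : forall i, measurable_fun setT (S i).
Hypothesis Mu : Hmx X + lam%:M \in unitmx.
Hypothesis iidS : iid P S.
Variable i0 : 'I_m.
Hypothesis Siso : forall j k : 'I_n,
  'E_P[fun w => (tcol (S i0 w) *m (tcol (S i0 w))^T) j k]%E =
  ((1%:M : 'M[R]_n) j k)%:E.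
Variable K : R.
Hypothesis SK : ('E_P[fun w =>
      let z := zrow X (S i0 w) in
      let u := urow y (S i0 w) in
      (normF (z *m z^T - Hmx X) ^+ 4 +
       norm2 (u *: z - gvec X y) ^+ 4)%R] <= K%:E)%E.

Let Om := Omega P X y lam (S i0).
Let psi_ k (t : n.-tuple R) := psi X y lam t k 0.
Let h a b (t : n.-tuple R) := (zrow X t *m (zrow X t)^T - Hmx X) a b.

Let m0 : (0 < m)%N.
Proof. exact: leq_ltn_trans (ltn_ord i0). Qed.

Let mpsi k : measurable_fun setT (psi_ k).
Proof. exact: (mxmeasurable_psi X y lam (@measurable_id _ _ setT)). Qed.

Let mh a b : measurable_fun setT (h a b).
Proof.
have : mxmeasurable (fun t : n.-tuple R => zrow X t *m (zrow X t)^T - Hmx X).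
  apply: mxmeasurableD; last exact: mxmeasurable_cst.
  exact: (mxmeasurable_outer X (@measurable_id _ _ setT)).
exact.
Qed.

Let spsi k : sqint P (psi_ k \o S i0).
Proof. exact: (sqint_psi (mS i0) SK Mu k). Qed.

Let psi0 k : mean P (psi_ k \o S i0) = 0.
Proof. exact: (mean_psi y (mS i0) Siso Mu k). Qed.

Let OmE k l : Om k l = mean P (fun w => psi_ k (S i0 w) * psi_ l (S i0 w)).
Proof.
rewrite /Om /Omega mxE -/(mean P _); congr mean; apply/funext => w.
by rewrite mxE big_ord1 [X in _ * X]mxE.
Qed.

(** Moments are known for the row [i0]; equality of laws carries them to row [i]. *)
Lemma psi_covariance i : has_covariance P (fun w => psi X y lam (S i w)) Om.
Proof.
apply: centered_covariance => [k|k|k l].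
- exact: (iid_sqint mS iidS i (mpsi k) (spsi k)).
- by have [_ E] := iid_mean mS iidS i (mpsi k) (sqint_integ (spsi k));
    rewrite -(psi0 k) -E.
have mkl : measurable_fun setT (fun t => psi_ k t * psi_ l t).
  exact: measurable_funM.
have ikl : integ P ((fun t => psi_ k t * psi_ l t) \o S i0).
  by apply: (integ_sqintM (spsi k) (spsi l)).
by have [_ E] := iid_mean mS iidS i mkl ikl; rewrite OmE -E.
Qed.

Let q : R := Num.sqrt m%:R.
Let q2 : q ^+ 2 = m%:R. Proof. by rewrite sqr_sqrtr. Qed.
Let q0 : 0 < q. Proof. by rewrite sqrtr_gt0 ltr0n. Qed.

Let W w := q^-1 *: \sum_(i < m) psi X y lam (S i w).

Let WE k : (fun w => W w k 0) = (fun w => q^-1 * \sum_i psi_ k (S i w)).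
Proof. by apply/funext => w; rewrite mxE summxE. Qed.

Let sum_sqint (f : n.-tuple R -> R) : measurable_fun setT f ->
  sqint P (f \o S i0) -> sqint P (fun w => \sum_i f (S i w)).
Proof.
by move=> mf sf; apply: sqint_sum => i; exact: (iid_sqint mS iidS i mf sf).
Qed.

Let W_sqint k : sqint P (fun w => W w k 0).
Proof. by rewrite WE; apply: sqintZ; exact: sum_sqint. Qed.

Let W_mean k l : mean P (fun w => W w k 0 * W w l 0) = Om k l.
Proof.
have -> : (fun w => W w k 0 * W w l 0) = (fun w => m%:R^-1 *
    ((\sum_i psi_ k (S i w)) * \sum_i psi_ l (S i w))).
  apply/funext => w; rewrite -[W w k 0]/((fun w => W w k 0) w) WE.
  by rewrite -[W w l 0]/((fun w => W w l 0) w) WE mulrACA -invfM -expr2 q2.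
rewrite meanZ; last by apply: integ_sqintM; exact: sum_sqint.
rewrite (iid_mean_sumM mS iidS (mpsi k) (mpsi l) (spsi k) (spsi l) (psi0 k)).
by rewrite mulKf ?pnatr_eq0 -?lt0n// OmE.
Qed.

Lemma leading_covariance : has_covariance P
  (fun w => q^-1 *: \sum_(i < m) psi X y lam (S i w)) Om.
Proof.
apply: centered_covariance => [k|k|k l]; [exact: W_sqint| |exact: W_mean].
rewrite WE; have is_ i : integ P (fun w => psi_ k (S i w)).
  by apply: sqint_integ; exact: (iid_sqint mS iidS i (mpsi k) (spsi k)).
rewrite meanZ; last exact: integ_sum.
rewrite mean_sum// big1 ?mulr0// => i _.
by have [_ E] := iid_mean mS iidS i (mpsi k) (sqint_integ (spsi k));
  rewrite -(psi0 k) -E.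
Qed.

Let D w := Hhat X (fun i => S i w) - Hmx X.

Let DE a b : (fun w => D w a b) = (fun w => m%:R^-1 * \sum_i h a b (S i w)).
Proof.
apply/funext => w; rewrite mxE [X in X + _]mxE summxE.
rewrite /h; under [in RHS]eq_bigr do rewrite mxE.
rewrite big_split/= sumr_const card_ord mulrDr -[X in _ = _ + _ * X]mulr_natl.
by rewrite mulKf ?pnatr_eq0 -?lt0n.
Qed.

Let D_moment a b : sqint P (fun w => D w a b) /\
  mean P (fun w => D w a b ^+ 2) <= (1 + K) / m%:R.
Proof.
have [sh hK] := sqint_outer (mS i0) SK a b.
have [ih h0] := mean_outer X (mS i0) Siso a b.
have ss := sum_sqint (mh a b) sh.
split; first by rewrite DE; exact: sqintZ.
have -> : (fun w => D w a b ^+ 2) = (fun w => m%:R^-1 ^+ 2 *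
    ((\sum_i h a b (S i w)) * \sum_i h a b (S i w))).
  by apply/funext => w; rewrite -[D w a b]/((fun w => D w a b) w) DE exprMn
    -expr2.
rewrite meanZ; last exact: integ_sqintM.
rewrite (iid_mean_sumM mS iidS (mh a b) (mh a b) sh sh h0).
rewrite expr2 -mulrA mulKf ?pnatr_eq0 -?lt0n// mulrC.
by rewrite ler_wpM2r ?invr_ge0//; under eq_fun do rewrite -expr2.
Qed.

(** [goodN] isolates the deterministic fact about inverses, so that randomness enters through [D]
    and [W] alone. With [delta], [B] and [K] fixed, only [q] and the variances [Om b b] depend on
    the sample size. *)
Lemma remainder_prob (delta B eps : R) :
  0 < delta -> 0 <= B -> 0 < eps -> 0 <= K ->
  (forall N : 'M[R]_d, (forall i j, `|N i j - (Hmx X + lam%:M) i j| < delta) ->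
    N \in unitmx /\ forall i j, `|invmx N i j| <= B) ->
  (P [set w | (eps < norm2
      (q *: (betahat X y lam (fun i => S i w) - beta X y lam)
      - q^-1 *: \sum_(i < m) psi X y lam (S i w)))%R] <=
  (q^-1 * \sum_(a < d) \sum_(b < d) ((1 + K) / delta ^+ 2
      + d%:R * B / eps * (1 + K + Om b b)))%:E)%E.
Proof.
move=> delta0 B0 eps0 K0 goodN.
(* With [q = sqrt m], AM-GM gives [|D| |W| <= q D^2 + W^2 / q], whose mean is
   O(1/q); [1 <= Z] as soon as [|D a b| >= delta] for some [a], [b], or the
   remainder exceeds [eps]. *)
set c := d%:R * B / eps.
have c0 : 0 <= c by rewrite !mulr_ge0// invr_ge0 ltW.
pose z a b w := delta ^- 2 * D w a b ^+ 2 +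
  c * (q * D w a b ^+ 2 + q^-1 * W w b 0 ^+ 2).
pose Z w := \sum_a \sum_b z a b w.
have iD2 a b : integ P (fun w => D w a b ^+ 2) := (D_moment a b).1.2.
have iW2 b : integ P (fun w => W w b 0 ^+ 2) := (W_sqint b).2.
have iqDW a b : integ P (fun w => q * D w a b ^+ 2 + q^-1 * W w b 0 ^+ 2).
  by apply: integD; exact: integZ.
have iz a b : integ P (z a b) by apply: integD; exact: integZ.
have iZ : integ P Z by apply: integ_sum => a; exact: integ_sum.
have qDW0 a b w : 0 <= q * D w a b ^+ 2 + q^-1 * W w b 0 ^+ 2.
  by have qge0 := ltW q0; rewrite addr_ge0// mulr_ge0 ?sqr_ge0 ?invr_ge0.
have z0 a b w : 0 <= z a b w.
  by apply: addr_ge0; rewrite mulr_ge0 ?invr_ge0 ?sqr_ge0.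
have Z0 w : 0 <= Z w by rewrite sumr_ge0// => a _; exact: sumr_ge0.
have zZ a b w : z a b w <= Z w.
  rewrite /Z (bigD1 a)//= (bigD1 b)//= -addrA lerDl addr_ge0 ?sumr_ge0//.
  by move=> ? _; exact: sumr_ge0.
apply: (@le_trans _ _ (mean P Z)%:E); last first.
  rewrite lee_fin mean_sum; last by move=> a; exact: integ_sum.
  rewrite mulr_sumr; apply: ler_sum => a _; rewrite mean_sum//.
  rewrite mulr_sumr; apply: ler_sum => b _.
  rewrite meanD; [|exact: integZ|exact: integZ].
  rewrite !meanZ// meanD; [|exact: integZ|exact: integZ].
  rewrite !meanZ//.
  have -> : mean P (fun w => W w b 0 ^+ 2) = Om b b.
    by rewrite -W_mean; congr mean; apply/funext => w; rewrite expr2.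
  have [_] := D_moment a b; move: (mean _ _) => v; rewrite -q2 => vK.
  (* The term from [delta] is of order 1/q^2; since [q >= 1] it is weakened to 1/q, the order of the
     other term. *)
  have q1 : 1 <= q by rewrite -sqrtr1 ler_wsqrtr// ler1n.
  have vq : v <= q^-1 * (1 + K).
    apply: (le_trans vK); rewrite mulrC ler_wpM2r ?addr_ge0//.
    by rewrite lef_pV2 ?posrE ?exprn_gt0// ler_eXnr.
  have qvq : q * v <= q^-1 * (1 + K).
    rewrite -(ler_pM2l q0) in vK; apply: (le_trans vK).
    suff -> : q * ((1 + K) / q ^+ 2) = q^-1 * (1 + K) by [].
    by field; rewrite gt_eqF.
  rewrite [leRHS]mulrDr; apply: lerD.
    by rewrite mulrC [leRHS]mulrA ler_wpM2r ?invr_ge0 ?sqr_ge0.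
  by rewrite [leRHS]mulrCA ler_wpM2l// mulrDr lerD2r.
apply: (le_trans _ (prob_ge1_le_mean iZ Z0)).
have mrem := mxmeasurable_remainder X y lam mS.
have mZ1 : measurable [set w | 1 <= Z w].
  rewrite -[X in measurable X]setTI; apply: (measurable_fun_ler _ _
    measurableT) => //.
  exact: integ_measurable iZ.
apply: le_measure; rewrite ?inE//.
  rewrite -[X in measurable X]setTI.
  under eq_fun do rewrite ltr_norm2 ?ltW//.
  apply: (measurable_fun_ltr _ _ measurableT) => //.
  by apply: measurable_sum => k; apply: measurable_funX; exact: mrem.
move=> w /=; have [/existsP[[a b] /= dD] _|/existsPn/= Dd] :=
    boolP [exists ab : 'I_d * 'I_d, delta <= `|D w ab.1 ab.2|].
  apply: le_trans (zZ a b w); rewrite -[leLHS]addr0; apply: lerD.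
    rewrite mulrC ler_pdivlMr ?exprn_gt0// mul1r -[leRHS]real_normK ?num_real//.
    by rewrite ler_pXn2r ?nnegrE// ltW.
  exact: mulr_ge0.
have [Mhu Mhb] : Hhat X (fun i => S i w) + lam%:M \in unitmx /\
    forall i j, `|invmx (Hhat X (fun i => S i w) + lam%:M) i j| <= B.
  apply: goodN => i j; have := Dd (i, j); rewrite -ltNge /= /D.
  by rewrite !mxE; congr (`|_| < _); ring.
rewrite (betahat_expansion y Mu m0 Mhu) -/q -/(W w) => epsV.
set I := invmx _ in Mhb epsV.
have VkE k : `|(I *m ((Hmx X - Hhat X (fun i => S i w)) *m W w)) k 0| <=
    \sum_a \sum_b B * (q * D w a b ^+ 2 + q^-1 * W w b 0 ^+ 2).
  rewrite mxE; apply: (le_trans (ler_norm_sum _ _ _)); apply: ler_sum => a _.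
  rewrite normrM -mulr_sumr; apply: ler_pM => //; rewrite mxE.
  apply: (le_trans (ler_norm_sum _ _ _)); apply: ler_sum => b _.
  have -> : (Hmx X - Hhat X (fun i => S i w)) a b = - D w a b.
    by rewrite /D -[Hmx X - _]opprB mxE.
  rewrite normrM normrN -(real_normK (num_real (D w a b))).
  rewrite -(real_normK (num_real (W w b 0))).
  move: (normr_ge0 (D w a b)) (normr_ge0 (W w b 0)).
  move: `|D w a b| `|W w b 0| => x v x0 v0.
  (* After multiplication by [q], the weighted AM-GM inequality follows from (q x - v)^2 >= 0. *)
  rewrite -(ler_pM2l q0) mulrDr mulrA mulVKf ?gt_eqF//.
  by have := sqr_ge0 (q * x - v); nra.
have epsS : eps < d%:R * \sum_a \sum_b B * (q * D w a b ^+ 2 + q^-1 * W w b 0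
  ^+ 2).
  apply: (lt_le_trans epsV); apply: (le_trans (norm2_le_sum _)).
  apply: (le_trans (ler_sum _ (fun k _ => VkE k))).
  by rewrite sumr_const card_ord mulr_natl.
(* The factor [d] counts the coordinates in the l1 bound on the norm and [B] bounds the inverse;
   [c = d B / eps] makes the second half of [Z] exceed 1 exactly when this bound exceeds [eps]. *)
have cS : eps * \sum_a \sum_b c * (q * D w a b ^+ 2 + q^-1 * W w b 0 ^+ 2) =
    d%:R * \sum_a \sum_b B * (q * D w a b ^+ 2 + q^-1 * W w b 0 ^+ 2).
  rewrite !mulr_sumr; apply: eq_bigr => a _; rewrite !mulr_sumr.
  by apply: eq_bigr => b _; rewrite /c; field; rewrite !gt_eqF.
rewrite -cS -[X in X < _]mulr1 ltr_pM2l// in epsS.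
apply: (le_trans (ltW epsS)); apply: ler_sum => a _; apply: ler_sum => b _.
by rewrite /z lerDr mulr_ge0 ?invr_ge0 ?sqr_ge0.
Qed.

End FiniteSample.

(** * Asymptotics *)

Section Limits.
Context {R : realType}.

Lemma cvg_mx_near d (M : nat -> 'M[R]_d) (L : 'M[R]_d) (e : R) : 0 < e ->
  M n @[n --> \oo] --> L ->
  \forall n \near \oo, forall i j, `|M n i j - L i j| < e.
Proof.
move=> e0 ML; have LB : nbhs L (fun N : 'M[R]_d => forall i j, `|N i j - L i j|
  < e).
  apply/(nbhs_ballP L); exists e => //= N [_ LN] i j.
  by have := LN i j; rewrite /ball/= distrC.
exact: ML LB.
Qed.

(** Bounding inverses around the fixed limit [L] makes [delta] and [B] independent of [n]: for large
    [n] the ball of radius [delta / 2] about [M n] lies in the ball of radius [delta] about [L]. *)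
Lemma inv_bound_near d (M : nat -> 'M[R]_d) (L : 'M[R]_d) (c : R) :
  (forall n, (M n)^T = M n) -> 0 < c ->
  (\forall n \near \oo, c <= lambda_min (M n)) ->
  M n @[n --> \oo] --> L ->
  exists delta B : R, [/\ 0 < delta, 0 <= B & \forall n \near \oo,
    forall N : 'M[R]_d, (forall i j, `|N i j - M n i j| < delta) ->
    N \in unitmx /\ forall i j, `|invmx N i j| <= B].
Proof.
move=> Msym c0 cM ML.
have cL : c ^+ d <= \det L.
  have dML : \det (M n) @[n --> \oo] --> \det L.
    exact: (cvg_comp _ _ ML (@continuous_det R d L)).
  apply: (cvgr_to_ge dML); near=> n.
  apply: det_ge_eigenvalue => //; apply: ge_lambda_min => //.
  by near: n.
have Lu : L \in unitmx.
  by rewrite unitmxE unitfE gt_eqF// (lt_le_trans _ cL)// exprn_gt0.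
have [delta [B [delta0 B0 LN]]] := invmx_bounded_near Lu.
exists (delta / 2), B; split => //; first by rewrite divr_gt0.
have h2 : 0 < delta / 2 by rewrite divr_gt0.
have := cvg_mx_near h2 ML; apply: filterS => n Mn N NM.
apply: LN => i j; rewrite (splitr delta).
have -> : N i j - L i j = (N i j - M n i j) + (M n i j - L i j) by ring.
by apply: (le_lt_trans (ler_normD _ _)); apply: ltrD.
Unshelve. all: by end_near. Qed.

Lemma cvg_div_sqrt (m : nat -> nat) (C : R) : m n @[n --> \oo] --> \oo ->
  (Num.sqrt (m n)%:R)^-1 * C @[n --> \oo] --> (0 : R).
Proof.
move=> mo; apply/cvgr0Pnorm_lt => e e0.
(* The threshold comes from |C| / sqrt m < e being equivalent to m > (|C| / e)^2. *)
near=> n; have mn : ((Num.bound ((`|C| / e) ^+ 2)).+1 <= m n)%N.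
  by near: n; exact: ((cvgnyPge m).1 mo).
rewrite normrM.
have Ce0 : 0 <= `|C| / e by rewrite divr_ge0// ltW.
have : (`|C| / e) ^+ 2 < (m n)%:R.
  apply: (lt_le_trans (archi_boundP (sqr_ge0 _))).
  by rewrite ler_nat ltnW.
have m0 : 0 < (m n)%:R :> R by rewrite ltr0n (leq_trans _ mn).
have s0 : 0 < Num.sqrt (m n)%:R :> R by rewrite sqrtr_gt0.
rewrite -[X in _ < X]sqr_sqrtr ?ltW// ltr_pXn2r ?nnegrE ?(ltW s0)// => lt.
rewrite normfV (ger0_norm (ltW s0)) mulrC ltr_pdivrMr// mulrC.
by rewrite -ltr_pdivrMr.
Unshelve. all: by end_near. Qed.

End Limits.

Theorem proposition1 (R : realType) (d : nat) (hd : (0 < d)%N)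
  (m : nat -> nat) (hm : forall n, (0 < m n)%N)
  (hm_oo : m n @[n --> \oo] --> \oo)
  (X : forall n, 'M[R]_(n, d)) (y : forall n, 'cV[R]_n)
  (lam : nat -> R) (hlam : forall n, (0 < n)%N -> 0 < lam n)
  (disp : nat -> measure_display) (T : forall n, measurableType (disp n))
  (P : forall n, probability (T n) R)
  (s : forall n, 'I_(m n) -> {RV (P n) >-> n.-tuple R})
  (* (i) *)
  (lam_oo : R) (hlam_oo : 0 <= lam_oo) (H : 'M[R]_d) (g : 'cV[R]_d)
  (hlam_lim : lam n @[n --> \oo] --> lam_oo)
  (hH_lim : Hmx (X n) @[n --> \oo] --> H)
  (hg_lim : gvec (X n) (y n) @[n --> \oo] --> g)
  (hmin : exists2 c0 : R, 0 < c0 &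
    \forall n \near \oo, c0 <= lambda_min (Hmx (X n) + (lam n)%:M))
  (* (ii) *)
  (hiid : forall n, (0 < n)%N -> iid (P n) (fun i w => s n i w))
  (hiso : forall n, (0 < n)%N -> forall j k : 'I_n,
    'E_(P n)[fun w => (tcol (s n (Ordinal (hm n)) w) *m
                       (tcol (s n (Ordinal (hm n)) w))^T) j k]%E =
    ((1%:M : 'M[R]_n) j k)%:E)
  (hmom : (ereal_sup [set 'E_(P n)[fun w =>
      let z := zrow (X n) (s n (Ordinal (hm n)) w) in
      let u := urow (y n) (s n (Ordinal (hm n)) w) in
      (normF (z *m z^T - Hmx (X n)) ^+ 4 +
       norm2 (u *: z - gvec (X n) (y n)) ^+ 4)%R] | n in [set n | (0 < n)%N]]
    < +oo)%E)
  (Om : 'M[R]_d)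
  (hOm : Omega (P n) (X n) (y n) (lam n) (s n (Ordinal (hm n)))
    @[n --> \oo] --> Om) :
  [/\ is_op1 P (fun n w =>
        Num.sqrt (m n)%:R *:
          (betahat (X n) (y n) (lam n) (fun i => s n i w)
           - beta (X n) (y n) (lam n))
        - (Num.sqrt (m n)%:R)^-1 *:
          \sum_(i < m n) psi (X n) (y n) (lam n) (s n i w)),
      forall n, (0 < n)%N -> forall i : 'I_(m n),
        has_covariance (P n) (fun w => psi (X n) (y n) (lam n) (s n i w))
          (Omega (P n) (X n) (y n) (lam n) (s n (Ordinal (hm n)))),
      forall n, (0 < n)%N ->
        has_covariance (P n)
          (fun w => (Num.sqrt (m n)%:R)^-1 *:
            \sum_(i < m n) psi (X n) (y n) (lam n) (s n i w))
          (Omega (P n) (X n) (y n) (lam n) (s n (Ordinal (hm n)))),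
      Omega (P n) (X n) (y n) (lam n) (s n (Ordinal (hm n)))
        @[n --> \oo] --> Om
    & forall (disp0 : measure_display) (T0 : measurableType disp0)
        (P0 : probability T0 R) (s0 : {RV P0 >-> R}),
        'E_P0[s0]%E = 0%E ->
        'E_P0[fun w => (s0 w ^+ 2)%R]%E = 1%E ->
        ('E_P0[fun w => (`|s0 w| ^+ 4)%R] < +oo)%E ->
        (forall n, (0 < n)%N -> forall i : 'I_(m n),
           mutually_independent (P n)
             (fun (j : 'I_n) (w : T n) => tnth (s n i w) j)
           /\ forall j : 'I_n,
             same_law (P n) P0 (fun w => tnth (s n i w) j) s0) ->
        forall n, (0 < n)%N ->
          let A := Amx (X n) (lam n) in
          let b := beta (X n) (y n) (lam n) in
          let r := resid (X n) (y n) (lam n) in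
          let kappa := fine ('E_P0[fun w => (s0 w ^+ 4)%R])%E - 3 in
          Omega (P n) (X n) (y n) (lam n) (s n (Ordinal (hm n))) =
          A *m ((norm2 r ^+ 2 / n%:R) *: Hmx (X n)
                + lam n ^+ 2 *: (b *m b^T)
                + (kappa / n%:R ^+ 2) *:
                  ((X n)^T *m diag_mx (\row_j (r j 0 * r j 0)) *m X n))
            *m A^T].
Proof.
have [c0 c00 cmin] := hmin.
pose M n := Hmx (X n) + (lam n)%:M.
have Mu n : (0 < n)%N -> M n \in unitmx by move=> n0;
  exact: ridge_unit (hlam n n0).
have ML : M n @[n --> \oo] --> H + lam_oo%:M.
  apply: cvgD => //; rewrite -scalemx1.
  under eq_cvg do rewrite -scalemx1.
  exact: cvgZr_tmp.
have Msym n : (M n)^T = M n by rewrite /M linearD/= trmx_Hmx tr_scalar_mx.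
have [delta [B [delta0 B0 good]]] := inv_bound_near Msym c00 cmin ML.
have [K K0 SK] : exists2 K : R, 0 <= K & forall n, (0 < n)%N ->
    ('E_(P n)[fun w =>
      let z := zrow (X n) (s n (Ordinal (hm n)) w) in
      let u := urow (y n) (s n (Ordinal (hm n)) w) in
      (normF (z *m z^T - Hmx (X n)) ^+ 4 +
       norm2 (u *: z - gvec (X n) (y n)) ^+ 4)%R] <= K%:E)%E.
  move: hmom; set E := (X in ereal_sup X) => Eoo.
  have leE e : E e -> (e <= ereal_sup E)%E by move=> Ee;
    exact: ereal_sup_ubound.
  have E0 : (0 <= ereal_sup E)%E.
    (* The member at [n = 1] shows that the supremum is nonnegative; with [Eoo] it is then a real
       number, which serves as [K]. *)
    apply: le_trans (leE _ (ex_intro2 _ _ 1%N _ erefl)) => //.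
    apply: expectation_ge0 => w; rewrite addr_ge0// exprn_ge0// sqrtr_ge0//.
  exists (fine (ereal_sup E)); first exact: fine_ge0.
  move=> n n0; rewrite fineK ?ge0_fin_numE//; apply: leE; by exists n.
have ms n i : measurable_fun setT (s n i) by exact: measurable_funP.
split.
- split.
    move=> n k; exact: (mxmeasurable_remainder (X n) (y n) (lam n) (ms n)).
  move=> eps eps0.
  (* Convergence of Omega_n bounds the variances of the leading sum uniformly for large [n]; the sum
     over [b] replaces a maximum, and 1 is the distance allowed to the limit. *)
  have [L OmL] : exists L, \forall n \near \oo, forall b,
      Omega (P n) (X n) (y n) (lam n) (s n (Ordinal (hm n))) b b <= L.
    exists (\sum_b (`|Om b b| + 1)).
    have := cvg_mx_near ltr01 hOm; apply: filterS => n OmN b.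
    rewrite (bigD1 b)//= -[leLHS]addr0; apply: lerD; last first.
      by apply: sumr_ge0 => j _; rewrite addr_ge0.
    rewrite -lerBlDl; apply: le_trans (ltW (OmN b b)).
    by apply: le_trans (ler_norm _); rewrite lerB// ler_norm.
  pose C := \sum_(a < d) \sum_(b < d) ((1 + K) / delta ^+ 2
      + d%:R * B / eps * (1 + K + L)).
  have Cto0 : ((Num.sqrt (m n)%:R)^-1 * C)%:E @[n --> \oo] --> (0 : \bar R)%E.
    by apply: cvg_EFin; [near=> n|exact: cvg_div_sqrt].
  apply: (@squeeze_cvge _ _ _ _ (cst 0%E) _ (fun n => ((Num.sqrt (m n)%:R)^-1 *
    C)%:E)) => //.
    near=> n; rewrite measure_ge0/=.
    have n0 : (0 < n)%N by near: n; exact: nbhs_infty_gt.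
    have goodn : forall N : 'M[R]_d, (forall i j, `|N i j - M n i j| < delta) ->
        N \in unitmx /\ forall i j, `|invmx N i j| <= B by near: n.
    have rem := remainder_prob (ms n) (Mu n n0) (hiid n n0) (hiso n n0)
      (SK n n0) delta0 B0 eps0 K0 goodn.
    apply: (le_trans rem).
    rewrite lee_fin ler_wpM2l ?invr_ge0//; apply: ler_sum => a _.
    apply: ler_sum => b _; rewrite lerD2l ler_wpM2l ?divr_ge0 ?mulr_ge0 ?(ltW
      eps0)//.
    by rewrite lerD2l; move: b; near: n.
  exact: cvg_cst.
- move=> n n0 i.
  exact: (psi_covariance (ms n) (Mu n n0) (hiid n n0) (hiso n n0) (SK n n0)).
- move=> n n0.
  exact: (leading_covariance (ms n) (Mu n n0) (hiid n n0) (hiso n n0) (SK n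
    n0)).
- exact: hOm.
move=> disp0 T0 P0 s0 Es0 Es2 Es4 law n n0 /=.
have ms0 : measurable_fun setT s0 by exact: measurable_funP.
have s4 : integ P0 (fun w => s0 w ^+ 4).
  apply/integrableP; split; first by apply/measurable_EFinP/measurable_funX.
  move: Es4; rewrite unlock; congr (_ < _)%E; apply: eq_integral => w _ /=.
  by rewrite normrX.
have [ind Vs] := law n n0 (Ordinal (hm n)).
have s1 : mean P0 s0 = 0 by rewrite /mean Es0.
have s2 : mean P0 (fun w => s0 w ^+ 2) = 1 by rewrite /mean Es2.
exact: (Omega_independent_coordinates (y n) (ms n _) (Mu n n0) ms0 s1 s2 s4 ind
  Vs).
Unshelve. all: by end_near. Qed.
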